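(* Unless $\mathcal{P}=\mathcal{NP}$, the Penalized Knapsack Problem does not admit a polynomial time algorithm with a bounded approximation ratio; i.e. there is no polynomial time algorithm and constant $r\ge 1$ such that on every instance the algorithm outputs a feasible solution of value at least $z^*/r$, where $z^*$ is the optimal value.
   Context: The Penalized Knapsack Problem: given $n$ items with non-negative integer profits $p_j$, weights $w_j$, penalties $\pi_j$ and a non-negative integer capacity $c$, choose $x\in\{0,1\}^n$ with $\sum_j w_jx_j\le c$ maximizing $\sum_j p_jx_j-\max\{\pi_j:x_j=1\}$ (the maximum over the empty set being $0$, so $z^*\ge0$). $z^*$ denotes the optimal value. *)

(* Defs.v *)
From HB Require Import structures.
From mathcomp Require Import all_boot all_order all_algebra.
From mathcomp Require Import reals.

Set Implicit Arguments.
Unset Strict Implicit.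
Unset Printing Implicit Defensive.

Import Order.TTheory GRing.Theory Num.Theory.

(** * Deterministic multi-tape Turing machines *)

Inductive move := MoveLeft | Stay | MoveRight.

(* The tape alphabet consists of the blank [None], the bits [Some (inl b)],
   and finitely many auxiliary symbols [Some (inr s)]. *)
Definition cell (S : finType) : finType := option (bool + S).

(* There are [tm_tapes.+1] tapes; the input is on tape [ord0] and the output
   is read on tape [ord_max].  The machine halts when [tm_trans] returns
   [None]. *)
Record tm := TM {
  tm_tapes : nat;
  tm_symbol : finType;
  tm_state : finType;
  tm_start : tm_state;
  tm_trans : tm_state -> {ffun 'I_tm_tapes.+1 -> cell tm_symbol} ->
    option (tm_state * ('I_tm_tapes.+1 -> cell tm_symbol * move))
}.

Section Run.
Variable M : tm.

Let symbol := cell (tm_symbol M).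

(* A two-way infinite tape [(l, r)]: [r] lists the cells from the scanned one
   rightwards, [l] those to its left, nearest first; all cells beyond are
   blank. *)
Definition tape : Type := seq symbol * seq symbol.

Definition scan (t : tape) : symbol := head None t.2.

Definition act (t : tape) (a : symbol * move) : tape :=
  let: (l, r) := t in
  let: (s, m) := a in
  match m with
  | MoveLeft => (behead l, head None l :: s :: behead r)
  | Stay => (l, s :: behead r)
  | MoveRight => (s :: l, behead r)
  end.

Definition config : Type := tm_state M * ('I_(tm_tapes M).+1 -> tape).

Definition next (c : config) : option config :=
  omap (fun qa => (qa.1, fun i => act (c.2 i) (qa.2 i)))
       (tm_trans c.1 [ffun i => scan (c.2 i)]).

Definition init (x : seq bool) : config :=
  (tm_start M,
   fun i => ([::], if i == ord0 then [seq Some (inl b) | b <- x] else [::])).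

(* Halting configurations are left unchanged. *)
Definition run (t : nat) (c : config) : config :=
  iter t (fun c => odflt c (next c)) c.

Definition halted (c : config) : Prop := next c = None.

Fixpoint leading_bits (s : seq symbol) : seq bool :=
  if s is Some (inl b) :: s' then b :: leading_bits s' else [::].

(* The bits from the output head up to the first cell not holding a bit. *)
Definition output (c : config) : seq bool := leading_bits (c.2 ord_max).2.

Definition outputs_within (x : seq bool) (t : nat) (y : seq bool) : Prop :=
  halted (run t (init x)) /\ output (run t (init x)) = y.

End Run.

(** * Polynomial time *)

(* Some machine, started on the code of any instance [a], halts within a
   number of steps polynomial in the length of that code, with an output that
   is acceptable for [a].  Nothing is required on strings that are not codes
   of instances. *)
Definition polytime_solvable (I : Type) (code : I -> seq bool)
    (good : I -> seq bool -> Prop) : Prop :=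
  exists (M : tm) (p : {poly nat}), forall a : I,
    exists y : seq bool,
      outputs_within M (code a) p.[size (code a)]%R y /\ good a y.

Definition language := pred (seq bool).

Definition inP (L : language) : Prop :=
  polytime_solvable id (fun x y => y = [:: L x]).

(* A prefix-free code: each bit is preceded by [true], [false] ends the word. *)
Definition delimit (x : seq bool) : seq bool :=
  flatten [seq [:: true; b] | b <- x] ++ [:: false].

Definition pair_code (x u : seq bool) : seq bool := delimit x ++ u.

Definition inNP (L : language) : Prop :=
  exists (V : language) (q : {poly nat}), inP V /\
    forall x : seq bool,
      L x <-> exists u : seq bool, size u <= q.[size x]%R /\ V (pair_code x u).

Definition P_equals_NP : Prop := forall L : language, inP L <-> inNP L.

(** * The Penalized Knapsack Problem *)

Record pkp := PKP {
  pkp_n : nat;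
  profit : 'I_pkp_n -> nat;
  weight : 'I_pkp_n -> nat;
  penalty : 'I_pkp_n -> nat;
  capacity : nat
}.

Definition solution (K : pkp) : finType := {ffun 'I_(pkp_n K) -> bool}.

Definition feasible (K : pkp) (x : solution K) : bool :=
  \sum_(j | x j) weight j <= capacity K.

(* The empty [\max] is 0; the objective may be negative. *)
Definition objective (K : pkp) (x : solution K) : int :=
  ((\sum_(j | x j) profit j)%:Z - (\max_(j | x j) penalty j)%:Z)%R.

(* The default value 0 is the objective of the empty, feasible, solution. *)
Definition optimum (K : pkp) : int :=
  \big[Order.max/0%R]_(x : solution K | feasible x) objective x.

Lemma optimum_attained (K : pkp) :
  exists2 x : solution K, feasible x & objective x = optimum K.
Proof.
rewrite /optimum; apply: (big_ind (fun z => exists2 x, feasible x & objective x = z)).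
- exists [ffun=> false]; first by rewrite /feasible big_pred0 // => j; rewrite ffunE.
  by rewrite /objective !big_pred0 // => j; rewrite ffunE.
- by move=> a b Ha Hb; case: (leP a b).
- by move=> x fx; exists x.
Qed.

Lemma optimum_ge (K : pkp) (x : solution K) :
  feasible x -> (objective x <= optimum K)%R.
Proof. by move=> fx; rewrite /optimum (bigD1 x) //= le_max lexx. Qed.

(* Little-endian binary digits, without superfluous zeros: [up_log 2 n.+1] is
   the least [e] such that [n < 2 ^ e]. *)
Definition binary (n : nat) : seq bool :=
  mkseq (fun i => odd (n %/ 2 ^ i)) (up_log 2 n.+1).

Definition nat_code (n : nat) : seq bool := delimit (binary n).

(* The number of items is implicit in this code: it is determined by the
   number of code words. *)
Definition pkp_code (K : pkp) : seq bool :=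
  nat_code (capacity K) ++
  flatten [seq nat_code (profit j) ++ nat_code (weight j) ++
               nat_code (penalty j) | j <- enum 'I_(pkp_n K)].

Definition solution_code (K : pkp) (x : solution K) : seq bool :=
  [seq x j | j <- enum 'I_(pkp_n K)].

Definition is_approximation (R : realType) (r : R) (K : pkp) (y : seq bool) :
    Prop :=
  exists x : solution K,
    [/\ y = solution_code x, feasible x &
        ((optimum K)%:~R / r <= (objective x)%:~R :> R)%R].

(* Main.v *)
Require Import Defs.
From mathcomp Require Import all_boot all_order all_algebra.
From mathcomp Require Import reals.
From HB Require Import structures.
From mathcomp Require Import boolp zify ring.

(* An approximation algorithm for the Penalized Knapsack Problem decides subset
   sum: if profits are twice the weights, the capacity is [T] and all penalties
   are [2 T - 1], then packings of weight [T] have value 1, the empty one has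
   value 0 and all others are negative, so that the algorithm returns a nonempty
   packing exactly if some packing has weight [T].

   Subset sum in turn decides every language in NP.  Lay out the computation of a
   verifier as a table whose rows are centred at the heads: column [j] holds, for
   each tape, the cells at distance [j] on both sides of its head.  A step then
   shifts each tape by at most one column, and the moves, which are common to the
   whole row, are passed on as the colours of the vertical edges; a first row of
   tiles guesses the certificate.  So the verifier accepts some certificate if
   and only if a rectangle can be tiled.  With the rows wound into one strip, the
   tile in cell [m] becomes a number whose only nonzero digits, in a large base,
   are the digits [m], [m + 1] and [m + W]: they count the tiles in the cell and
   make the codes of the two colours on an edge add up to a constant if and only
   if the colours agree.  Numbers of this form are repetitive enough to be printed
   by a simple stack program. *)

Set Implicit Arguments.
Unset Strict Implicit.
Unset Printing Implicit Defensive.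

(** * Machines acting on two-way infinite tapes *)

(** The reduction must be an actual Turing machine, and this shapes the construction: large numbers
    have to be printed without arithmetic on them. Therefore the block width depends on the tile set
    alone, the input contributes only its bits and some repetition counts, and the penalty must
    arise from the word for [T] by a local edit, which is possible because [T] is made odd.

    Centring the rows at the heads copes with several tapes at once: all scanned cells meet in
    column 0, so a single tile evaluates the transition and no state travels along a row. The price
    is that a move shifts the rest of the row, which each tile can do once it knows the moves and
    the contents of its neighbours.

    A subset sum only prescribes totals, and a selection may contain any set of tiles. So the base
    has to exclude carries even if all tiles are chosen everywhere, before a count digit equal to 1
    can be used to conclude that each cell holds exactly one tile.

    Winding the rectangle makes every constraint a matter of the offsets 1 and [W], but glues the
    end of a row to the start of the next; the vertical colours have to undo this. *)

Section Ftape.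
Variable S : finType.

(** Halves are functions of the distance from the head, so that tapes differing only in trailing
    blanks are equal and the effect of a program can be stated as an equation. The scanned cell is
    cell 0 of the right half. *)
Definition ftape : Type := (nat -> cell S) * (nat -> cell S).

Definition scons (T : Type) (a : T) (f : nat -> T) (i : nat) : T :=
  if i is i'.+1 then f i' else a.

Definition stail (T : Type) (f : nat -> T) (i : nat) : T := f i.+1.

Definition fact (t : ftape) (a : cell S * move) : ftape :=
  let: (l, r) := t in
  match a.2 with
  | MoveLeft => (stail l, scons (l 0) (scons a.1 (stail r)))
  | Stay => (l, scons a.1 (stail r))
  | MoveRight => (scons a.1 l, stail r)
  end.

Definition fblank : ftape := (fun=> None, fun=> None).

(** The top is under the head and all other cells are blank. Popping erases the bit before moving
    on, so the left half stays blank. *)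
Definition stack (s : seq bool) : ftape :=
  (fun=> None, nth None [seq Some (inl b) | b <- s]).

Lemma scons_tail (f : nat -> cell S) : scons (f 0) (stail f) = f.
Proof. by apply: funext => -[]. Qed.

Lemma fact_stay (t : ftape) : fact t (t.2 0, Stay) = t.
Proof. by case: t => l r; rewrite /fact /= scons_tail. Qed.

Lemma stack_cons b s : stack (b :: s) = (fun=> None, scons (Some (inl b)) (stack s).2).
Proof. by congr pair; apply: funext => -[]. Qed.

Lemma stack_nil : stack [::] = fblank.
Proof. by congr pair; apply: funext => -[]. Qed.

Lemma stack_pop b s : fact (stack (b :: s)) (None, MoveRight) = stack s.
Proof. by rewrite stack_cons; congr pair; apply: funext => -[]. Qed.

Lemma stack_push b s :
  fact (fact (stack s) ((stack s).2 0, MoveLeft)) (Some (inl b), Stay) =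
  stack (b :: s).
Proof. by rewrite stack_cons; congr pair; apply: funext => -[|[|]]. Qed.

End Ftape.

(* A program is a Turing machine whose tapes are indexed by an arbitrary finite
   type. *)
Record prog (I S : finType) := Prog {
  pstate : finType;
  pstart : pstate;
  ptrans : pstate -> {ffun I -> cell S} -> option (pstate * (I -> cell S * move))
}.

(** * Sequencing, branching and iteration of programs *)

Section Prog.
Variables I S : finType.
Implicit Types (A B : prog I S) (tp : I -> ftape S).

Definition fscan tp : {ffun I -> cell S} := [ffun i => (tp i).2 0].

Definition fnext A (c : pstate A * (I -> ftape S)) :=
  omap (fun qa => (qa.1, fun i => fact (c.2 i) (qa.2 i))) (ptrans c.1 (fscan c.2)).

Definition fstep A c := odflt c (@fnext A c).

(** [t] is only an upper bound, so that costs can be rounded up at will. *)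
Definition reach A tp t tp' := exists n q,
  [/\ n <= t, iter n (@fstep A) (pstart A, tp) = (q, tp') & fnext (q, tp') = None].

Lemma reach_le A tp t1 t2 tp' : t1 <= t2 -> reach A tp t1 tp' -> reach A tp t2 tp'.
Proof. by move=> le12 [n [q [le1 e h]]]; exists n, q; split=> //; apply: leq_trans le1 le12. Qed.

Lemma iter_fstep_halted A c n : @fnext A c = None -> iter n (@fstep A) c = c.
Proof. by move=> h; elim: n => //= n ->; rewrite /fstep h. Qed.

Lemma fstep_trans A q tp q' a :
  ptrans q (fscan tp) = Some (q', a) ->
  @fstep A (q, tp) = (q', fun i => fact (tp i) (a i)).
Proof. by rewrite /fstep /fnext /= => ->. Qed.

Lemma fnext_halt A q tp : (@fnext A (q, tp) = None) <-> ptrans q (fscan tp) = None.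
Proof. by rewrite /fnext /=; case: ptrans. Qed.

Definition stay_all (s : {ffun I -> cell S}) (i : I) : cell S * move := (s i, Stay).

Lemma fact_stay_all tp : (fun i => fact (tp i) (stay_all (fscan tp) i)) = tp.
Proof. by apply: funext => i; rewrite /stay_all ffunE fact_stay. Qed.

(* Nothing is required of [B] in [f q] where [A] halts in [q]: there [B] may go on. *)
Lemma iter_embed A B (f : pstate A -> pstate B) :
  (forall q s, ptrans (f q) s = if ptrans q s is Some (q', a) then Some (f q', a)
                                else ptrans (f q) s) ->
  forall n q tp q' tp', iter n (@fstep A) (q, tp) = (q', tp') ->
  exists2 m, m <= n & iter m (@fstep B) (f q, tp) = (f q', tp').
Proof.
move=> fP; elim=> [|n IHn] q tp q' tp'; first by case=> <- <-; exists 0.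
rewrite iterSr; case E: (@fnext A (q, tp)) => [[q1 tp1]|].
- rewrite /fstep E /= -/fstep => /IHn[m lemn e]; exists m.+1 => //.
  rewrite iterSr -{}e; congr iter; move: E; rewrite /fnext /fstep /fnext /= fP.
  by case: ptrans => [[q2 a]|] //= -[<- <-].
- by rewrite -iterSr iter_fstep_halted // => -[<- <-]; exists 0.
Qed.

Definition skip : prog I S := @Prog I S unit tt (fun _ _ => None).

Lemma reach_skip tp : reach skip tp 0 tp.
Proof. by exists 0, tt. Qed.

Definition pseq A B : prog I S :=
  @Prog I S (pstate A + pstate B)%type (inl (pstart A)) (fun q s =>
    match q with
    | inl q => if ptrans q s is Some (q', a) then Some (inl q', a)
               else Some (inr (pstart B), stay_all s)
    | inr q => if ptrans q s is Some (q', a) then Some (inr q', a) else None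
    end).

(** The extra step is the handover: where [A] has no transition, the sequence moves to the start of
    [B], rewriting every scanned symbol in place. *)
Lemma reach_seq A B tp t1 tp1 t2 tp2 :
  reach A tp t1 tp1 -> reach B tp1 t2 tp2 -> reach (pseq A B) tp (t1 + t2.+1) tp2.
Proof.
move=> [n1 [q1 [le1 e1 h1]]] [n2 [q2 [le2 e2 h2]]].
have [q s|m1 lem1 {}e1] := @iter_embed A (pseq A B) inl _ _ _ _ _ _ e1.
  by rewrite /=; case: ptrans => [[]|].
have [q s|m2 lem2 {}e2] := @iter_embed B (pseq A B) inr _ _ _ _ _ _ e2.
  by rewrite /=; case: ptrans => [[]|].
exists (m2 + (1 + m1)), (inr q2); split; first lia.
- rewrite iterD iterD e1 /=.
  have -> : @fstep (pseq A B) (inl q1, tp1) = (inr (pstart B), tp1).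
    rewrite (@fstep_trans (pseq A B) _ _ (inr (pstart B)) (stay_all (fscan tp1))).
      by rewrite fact_stay_all.
    by move/fnext_halt: h1 => /= ->.
  by rewrite e2.
- by apply/fnext_halt => /=; move/fnext_halt: h2 => /= ->.
Qed.

Definition on_tape (r : I) (a : cell S * move) (s : {ffun I -> cell S}) (i : I) :=
  if i == r then a else stay_all s i.

Definition upd (T : Type) (f : I -> T) (r : I) (v : T) (i : I) : T :=
  if i == r then v else f i.

Lemma fact_on_tape tp r a :
  (fun i => fact (tp i) (on_tape r a (fscan tp) i)) = upd tp r (fact (tp r) a).
Proof.
apply: funext => i; rewrite /on_tape /upd; case: eqP => [->|_] //.
by rewrite /stay_all ffunE fact_stay.
Qed.

Lemma upd_same (T : Type) (f : I -> T) r v : upd f r v r = v.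
Proof. by rewrite /upd eqxx. Qed.

Lemma upd_neq (T : Type) (f : I -> T) r i v : i != r -> upd f r v i = f i.
Proof. by rewrite /upd => /negPf->. Qed.

Lemma upd_upd (T : Type) (f : I -> T) r v w : upd (upd f r v) r w = upd f r w.
Proof. by apply: funext => i; rewrite /upd; case: eqP. Qed.

Definition push (b : bool) (r : I) : prog I S :=
  @Prog I S (option bool) (Some false) (fun q s =>
    match q with
    | Some false => Some (Some true, on_tape r (s r, MoveLeft) s)
    | Some true => Some (None, on_tape r (Some (inl b), Stay) s)
    | None => None
    end).

Definition stacks (st : I -> seq bool) (i : I) : ftape S := stack S (st i).

Lemma stacks_upd st r s : stacks (upd st r s) = upd (stacks st) r (stack S s).
Proof. by apply: funext => i; rewrite /stacks /upd; case: eqP. Qed.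

Lemma upd_id (T : Type) (f : I -> T) r : upd f r (f r) = f.
Proof. by apply: funext => i; rewrite /upd; case: eqP => [->|]. Qed.

Definition computes A st t st' := reach A (stacks st) t (stacks st').

Lemma computes_push b r st : computes (push b r) st 2 (upd st r (b :: st r)).
Proof.
exists 2, None; split=> //=; first rewrite (@fstep_trans (push b r) (Some false) _ _ _ erefl).
rewrite (@fstep_trans (push b r) (Some true) _ _ _ erefl); congr pair.
rewrite fact_on_tape fact_on_tape ffunE stacks_upd upd_upd.
by rewrite /on_tape eqxx /stacks stack_push.
Qed.

(* Pops the register [r] and runs [A1] or [A0] according to the bit found; does
   nothing if [r] is empty.  If [back] holds this is repeated until [r] is empty. *)
Definition branch (back : bool) (r : I) A1 A0 : prog I S :=
  @Prog I S (option (pstate A1 + pstate A0)) None (fun q s =>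
    match q with
    | None => if s r is Some (inl b) then
        Some (Some (if b then inl (pstart A1) else inr (pstart A0)),
              on_tape r (None, MoveRight) s)
      else None
    | Some q =>
      if (match q with
          | inl q => omap (fun qa => (inl qa.1, qa.2)) (ptrans q s)
          | inr q => omap (fun qa => (inr qa.1, qa.2)) (ptrans q s)
          end) is Some (q', a) then Some (Some q', a)
      else if back then Some (None, stay_all s) else None
    end).

Lemma branch_start back r A1 A0 st b s : st r = b :: s ->
  @fstep (branch back r A1 A0) (None, stacks st) =
  (Some (if b then inl (pstart A1) else inr (pstart A0)), stacks (upd st r s)).
Proof.
move=> er; rewrite (@fstep_trans (branch back r A1 A0) None _
  (Some (if b then inl (pstart A1) else inr (pstart A0)))
  (on_tape r (None, MoveRight) (fscan (stacks st)))).
  by rewrite fact_on_tape stacks_upd {2}/stacks er stack_pop.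
by rewrite /= ffunE /stacks er.
Qed.

(** Either body embeds in the whole. The last clause tells what replaces its halting: a silent step
    back to the test, or a halt of the whole. *)
Lemma branch_body back r A1 A0 b tp t tp' :
  reach (if b then A1 else A0) tp t tp' ->
  exists n q, [/\ n <= t,
    iter n (@fstep (branch back r A1 A0))
      (Some (if b then inl (pstart A1) else inr (pstart A0)), tp) = (Some q, tp')
  & ptrans (p := branch back r A1 A0) (Some q) (fscan tp') =
      if back then Some (None, stay_all (fscan tp')) else None].
Proof.
case: b => -[n [q [len e h]]].
- have [q' s|m lem {}e] := @iter_embed A1 (branch back r A1 A0) (Some \o inl) _ _ _ _ _ _ e.
    by rewrite /=; case: ptrans => [[]|].
  exists m, (inl q); split=> //; first exact: leq_trans lem len.
  by rewrite /=; move/fnext_halt: h => ->.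
- have [q' s|m lem {}e] := @iter_embed A0 (branch back r A1 A0) (Some \o inr) _ _ _ _ _ _ e.
    by rewrite /=; case: ptrans => [[]|].
  exists m, (inr q); split=> //; first exact: leq_trans lem len.
  by rewrite /=; move/fnext_halt: h => ->.
Qed.

Lemma computes_branch_nil back r A1 A0 st :
  st r = [::] -> computes (branch back r A1 A0) st 0 st.
Proof.
move=> er; exists 0, None; split=> //.
by apply/fnext_halt; rewrite /= ffunE /stacks er.
Qed.

Lemma computes_if r A1 A0 st b s t st' : st r = b :: s ->
  computes (if b then A1 else A0) (upd st r s) t st' ->
  computes (branch false r A1 A0) st t.+1 st'.
Proof.
move=> er /(branch_body false r)[n [q [len e h]]].
exists n.+1, (Some q); split=> //; last exact/fnext_halt.
by rewrite iterSr (branch_start _ _ _ er).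
Qed.

Lemma computes_loop r A1 A0 st b s t1 st1 t2 st2 : st r = b :: s ->
  computes (if b then A1 else A0) (upd st r s) t1 st1 ->
  computes (branch true r A1 A0) st1 t2 st2 ->
  computes (branch true r A1 A0) st (t1 + t2).+2 st2.
Proof.
move=> er /(branch_body true r)[n [q [len e h]]] [n2 [q2 [len2 e2 h2]]].
exists (n2 + (1 + (n + 1))), q2; split=> //; first lia.
rewrite !iterD.
have -> : iter 1 (@fstep (branch true r A1 A0)) (pstart (branch true r A1 A0), stacks st) =
  (Some (if b then inl (pstart A1) else inr (pstart A0)), stacks (upd st r s)).
  exact: branch_start.
by rewrite e /= (fstep_trans h) fact_stay_all.
Qed.

Lemma computes_seq A B st t1 st1 t2 st2 :
  computes A st t1 st1 -> computes B st1 t2 st2 -> computes (pseq A B) st (t1 + t2.+1) st2.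
Proof. exact: reach_seq. Qed.

End Prog.

(** * Composition of machines *)

Section Lift.
Variables (I J S T : finType) (f : J -> I) (f' : I -> option J).
Variables (g : T -> S) (g' : S -> option T).
Hypotheses (fK : pcancel f f') (f'K : ocancel f' f) (gK : pcancel g g').

Definition cmap (c : cell T) : cell S :=
  match c with
  | Some (inr s) => Some (inr (g s))
  | Some (inl b) => Some (inl b)
  | None => None
  end.

Definition cproj (c : cell S) : cell T :=
  match c with
  | Some (inr s) => omap inr (g' s)
  | Some (inl b) => Some (inl b)
  | None => None
  end.

Lemma cmapK : cancel cmap cproj.
Proof. by case=> [[b|s]|] //=; rewrite gK. Qed.

Definition ftmap (t : ftape T) : ftape S := (cmap \o t.1, cmap \o t.2).

Lemma ftmap_fact t a : ftmap (fact t a) = fact (ftmap t) (cmap a.1, a.2).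
Proof.
by case: t a => l r [s []]; rewrite /ftmap /=; congr pair; apply: funext => -[|[|i]].
Qed.

Lemma ftmap_stack s : ftmap (stack T s) = stack S s.
Proof.
congr pair; apply: funext => i /=.
by elim: s i => [|b s IHs] [|i] //=.
Qed.

(** Lets two machines with their own tapes and alphabets live side by side. Symbols foreign to [A]
    would be read as blanks, but none ever reaches its tapes if they start with images of its own
    symbols. *)
Definition lift (A : prog J T) : prog I S :=
  @Prog I S (pstate A) (pstart A) (fun q s =>
    omap (fun qa => (qa.1, fun i => if f' i is Some j then (cmap (qa.2 j).1, (qa.2 j).2)
                                    else stay_all s i))
         (ptrans q [ffun j => cproj (s (f j))])).

Lemma reach_lift A tp t tp' (big : I -> ftape S) :
  (forall j, big (f j) = ftmap (tp j)) -> reach A tp t tp' ->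
  reach (lift A) big t (fun i => if f' i is Some j then ftmap (tp' j) else big i).
Proof.
move=> bigE [n [q [len e h]]].
pose ext (tq : J -> ftape T) i := if f' i is Some j then ftmap (tq j) else big i.
have scanE tq : [ffun j => cproj (fscan (ext tq) (f j))] = fscan tq.
  by apply/ffunP => j; rewrite !ffunE /ext fK /= cmapK.
have extE : big = ext tp.
  by apply: funext => i; rewrite /ext; case E: (f' i) (f'K i) => [j|] //= <-.
exists n, q; split=> //; last first.
  by move/fnext_halt: h => h; apply/fnext_halt; rewrite /= scanE h.
rewrite -/(ext tp') {1}extE; elim: n {len} q tp' e {h} => [|n IHn] q tp' /=; first by case=> <- <-.
case E: (iter n _ _) => [q1 tp1]; rewrite (IHn _ _ E) /fstep /fnext /= scanE.
case: ptrans => [[q2 a]|] //= [<- <-]; congr pair; apply: funext => i; rewrite /ext.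
case E': (f' i) => [j|]; first by rewrite ftmap_fact.
by rewrite /stay_all ffunE E' fact_stay.
Qed.

End Lift.

(** * Handing the output of one machine to another *)

Section Copy.
Variables (I S : finType) (a b : I).
Hypothesis neq_ab : a != b.

Definition foutput (t : ftape S) (y : seq bool) : Prop :=
  (forall i, i < size y -> t.2 i = Some (inl (nth false y i))) /\
  (forall c, t.2 (size y) <> Some (inl c)).

(** The states are [Some false] for copying rightwards, [Some true] for rewinding [b], and [None]
    for the end. The source may hold anything around its output; the target becomes a clean [stack],
    as the next machine expects of its input. *)
Definition copy_output : prog I S :=
  @Prog I S (option bool) (Some false) (fun q s =>
    match q with
    | Some false =>
      if s a is Some (inl _) then
        Some (Some false, fun i => if i == a then (s a, MoveRight)
                                   else on_tape b (s a, MoveRight) s i)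
      else Some (Some true, on_tape b (s b, MoveLeft) s)
    | Some true =>
      if s b is Some (inl _) then Some (Some true, on_tape b (s b, MoveLeft) s)
      else Some (None, on_tape b (s b, MoveRight) s)
    | None => None
    end).

Definition zipper (l r : seq bool) : ftape S := ((stack S l).2, (stack S r).2).

Lemma zipper_left l r c :
  fact (zipper (c :: l) r) ((stack S r).2 0, MoveLeft) = zipper l (c :: r).
Proof. by congr pair; apply: funext => -[|[|i]]. Qed.

(** The rewind overshoots to the blank left of the word, and one move right then puts the head on
    its first bit. *)
Lemma rewind_steps tp l r :
  exists2 n, n <= size l + 1 &
  iter n (@fstep _ _ copy_output)
    (Some true, upd tp b (fact (zipper l r) ((stack S r).2 0, MoveLeft))) =
  (None, upd tp b (stack S (catrev l r))).
Proof.
elim: l r => [|c l IHl] r.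
  set t := fact _ _; exists 1 => //; rewrite [iter 1 _ _]/=.
  rewrite (@fstep_trans _ _ copy_output (Some true) _ None
    (on_tape b (t.2 0, MoveRight) (fscan (upd tp b t)))); last first.
    by rewrite /= ffunE /upd eqxx.
  rewrite fact_on_tape upd_upd upd_same; congr (_, upd _ _ _).
  by congr pair; apply: funext => -[|[|i]].
have [n len e] := IHl (c :: r); exists n.+1; first by rewrite addSn.
rewrite iterSr zipper_left -e; congr iter.
rewrite (@fstep_trans _ _ copy_output (Some true) _ (Some true)
  (on_tape b ((zipper l (c :: r)).2 0, MoveLeft) (fscan (upd tp b (zipper l (c :: r)))))).
  by rewrite fact_on_tape upd_upd upd_same.
by rewrite /= ffunE upd_same.
Qed.

Lemma foutput_cons t c y : foutput t (c :: y) ->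
  t.2 0 = Some (inl c) /\ foutput (fact t (Some (inl c), MoveRight)) y.
Proof.
case: t => l r [h h']; split; first exact: (h 0).
by split=> [i lti|c']; [exact: (h i.+1) | exact: h'].
Qed.

Lemma copy_steps tp l y : tp b = zipper l [::] -> foutput (tp a) y ->
  exists n tp', [/\ n <= size y + 1,
    iter n (@fstep _ _ copy_output) (Some false, tp) =
      (Some true, upd tp' b (fact (zipper (catrev y l) [::]) (None, MoveLeft))) &
    forall i, i != a -> i != b -> tp' i = tp i].
Proof.
elim: y l tp => [|c y IHy] l tp tpb.
  move=> [_ /= h]; exists 1, tp; split=> //=.
  rewrite (@fstep_trans _ _ copy_output (Some false) _ (Some true)
    (on_tape b (None, MoveLeft) (fscan tp))) ?fact_on_tape ?tpb //=.
  rewrite !ffunE tpb /=.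
  by case E: ((tp a).2 0) => [[c|]|] //; case: (h c).
move=> /foutput_cons[hc h].
set act := fun i => if i == a then ((tp a).2 0, MoveRight)
                    else on_tape b ((tp a).2 0, MoveRight) (fscan tp) i.
pose tp1 i := fact (tp i) (act i).
have [|| n [tp' [len e h']]] := IHy (c :: l) tp1.
- rewrite /tp1 /act eq_sym (negPf neq_ab) /on_tape eqxx tpb hc.
  by congr pair; apply: funext => -[|i].
- by rewrite /tp1 /act eqxx hc.
exists n.+1, tp'; split; first by rewrite addSn.
  rewrite iterSr (@fstep_trans _ _ copy_output (Some false) _ (Some false) act) //.
  by rewrite /= /act !ffunE hc.
move=> i ia ib; rewrite h' // /tp1 /act (negPf ia) /on_tape (negPf ib).
by rewrite /stay_all ffunE fact_stay.
Qed.

Lemma reach_copy_output tp y : tp b = fblank S -> foutput (tp a) y ->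
  exists2 tp', reach copy_output tp (2 * size y + 2) tp' &
    tp' b = stack S y /\ forall i, i != a -> i != b -> tp' i = tp i.
Proof.
move=> tpb h.
have tpb' : tp b = zipper [::] [::].
  by rewrite tpb; congr pair; apply: funext => -[].
have [n [tp1 [len e h1]]] := copy_steps tpb' h.
have [m lem e'] := rewind_steps tp1 (catrev y [::]) [::].
exists (upd tp1 b (stack S y)).
  exists (m + n), None; split=> //.
    by move: lem; rewrite -/(rev y) size_rev; lia.
  by rewrite iterD e e' -!/(rev _) revK.
rewrite upd_same; split=> // i ia ib; rewrite -h1 //.
by rewrite /upd (negPf ib).
Qed.

End Copy.

(** * Programs versus the machines of the statement *)

Definition abs_tape (S : finType) (t : seq (cell S) * seq (cell S)) : ftape S :=
  (nth None t.1, nth None t.2).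

Definition prog_of (M : tm) : prog 'I_(tm_tapes M).+1 (tm_symbol M) :=
  Prog (tm_start M) (@tm_trans M).

Definition finput (S : finType) k (x : seq bool) (i : 'I_k.+1) : ftape S :=
  if i == ord0 then stack S x else fblank S.

Section Abstraction.
Variable M : tm.

Definition abs_config (c : config M) :
  pstate (prog_of M) * ('I_(tm_tapes M).+1 -> ftape (tm_symbol M)) :=
  (c.1, fun i => abs_tape (c.2 i)).

Lemma abs_act (t : tape M) a : abs_tape (act t a) = fact (abs_tape t) a.
Proof.
by case: t a => [[|x l] [|y r]] [s []]; congr pair; apply: funext => -[|[|[|i]]].
Qed.

Lemma abs_next (c : config M) : fnext (abs_config c) = omap abs_config (Defs.next c).
Proof.
case: c => q t; rewrite /fnext /Defs.next /=.
have -> : fscan (fun i => abs_tape (t i)) = [ffun i => scan (t i)].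
  by apply/ffunP => i; rewrite !ffunE /scan -nth0.
case: tm_trans => [[q' a]|] //=; congr Some; congr pair.
by apply: funext => i; rewrite abs_act.
Qed.

Lemma abs_run n (c : config M) :
  abs_config (run n c) = iter n (@fstep _ _ (prog_of M)) (abs_config c).
Proof.
rewrite /run; elim: n => //= n <-.
by rewrite /fstep abs_next; case: Defs.next.
Qed.

Lemma abs_halted (c : config M) : halted c <-> fnext (abs_config c) = None.
Proof. by rewrite abs_next /halted; case: Defs.next. Qed.

Lemma abs_init x : abs_config (init M x) = (tm_start M, finput (tm_symbol M) x).
Proof.
congr pair; apply: funext => i; rewrite /finput /=.
by case: eqP => _; congr pair; apply: funext => -[].
Qed.

Lemma foutput_leading_bits (l r : seq (cell (tm_symbol M))) y :
  foutput (abs_tape (l, r)) y <-> leading_bits r = y.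
Proof.
rewrite /foutput /=; elim: r y => [|[[c|s]|] r IHr] y /=.
- split=> [[h _]|<-]; first by case: y h => // c y /(_ 0 isT).
  by split.
- case: y => [|c' y]; first by split=> // -[_ /(_ c)].
  split=> [[h h']|[-> /IHr[h h']]]; last by split=> // -[|i] // /h.
  have [->] := h 0 isT; congr cons; apply/IHr.
  by split=> // i lti; apply: (h i.+1).
- split=> [[h _]|<-]; first by case: y h => // c y /(_ 0 isT).
  by split.
- split=> [[h _]|<-]; first by case: y h => // c y /(_ 0 isT).
  by split.
Qed.

Lemma outputs_withinP x t y : outputs_within M x t y <->
  exists2 tp, reach (prog_of M) (finput (tm_symbol M) x) t tp & foutput (tp ord_max) y.
Proof.
rewrite /outputs_within; split.
- case E: (abs_config (run t (init M x))) => [q tp].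
  move=> [/abs_halted + hy]; rewrite E => h; exists tp; last first.
    case: E => _ <-; case E': (run t _) hy => [q' tps] /=; rewrite /output /=.
    by case: (tps ord_max) => l r /foutput_leading_bits.
  by exists t, q; split=> //; rewrite -E abs_run abs_init.
- move=> [tp [n [q [len e h]]] hy].
  have E : abs_config (run t (init M x)) = (q, tp).
    by rewrite abs_run abs_init -(subnK len) iterD e iter_fstep_halted.
  split; first by apply/abs_halted; rewrite E.
  move: E hy => [_ <-]; case: (run t _) => [q' tps] /=; rewrite /output /=.
  by case: (tps ord_max) => l r /foutput_leading_bits.
Qed.

End Abstraction.

Section Reindex.
Variables (I S : finType) (k : nat) (e : 'I_k.+1 -> I) (e' : I -> 'I_k.+1).
Hypothesis e'K : cancel e' e.

Definition tm_of (A : prog I S) : tm :=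
  @TM k S (pstate A) (pstart A) (fun q s =>
    omap (fun qa => (qa.1, qa.2 \o e)) (ptrans q [ffun i => s (e' i)])).

Lemma reach_tm_of A tp t tp' :
  reach A tp t tp' -> reach (prog_of (tm_of A)) (tp \o e) t (tp' \o e).
Proof.
have scanE tq : [ffun i => fscan (tq \o e) (e' i)] = fscan tq :> {ffun I -> cell S}.
  by apply/ffunP => i; rewrite !ffunE /= e'K.
move=> [n [q [len E h]]]; exists n, q; split=> //; last first.
  by move/fnext_halt: h => h; apply/fnext_halt; rewrite /= scanE h.
elim: n {len} q tp' E {h} => [|n IHn] q tp' /=; first by case=> <- <-.
case E: (iter n _ _) => [q1 tp1]; rewrite (IHn _ _ E) /fstep /fnext /= scanE.
by case: ptrans => [[q2 a]|] //= [<- <-].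
Qed.

End Reindex.

Section Composition.
Variables M N : tm.

Let I := ('I_(tm_tapes M).+1 + 'I_(tm_tapes N).+1)%type.
Let S := (tm_symbol M + tm_symbol N)%type.

Definition get_inl (A B : Type) (x : A + B) : option A := if x is inl a then Some a else None.
Definition get_inr (A B : Type) (x : A + B) : option B := if x is inr b then Some b else None.

Lemma get_inlK (A B : Type) : pcancel (@inl A B) (@get_inl A B). Proof. by []. Qed.
Lemma get_inrK (A B : Type) : pcancel (@inr A B) (@get_inr A B). Proof. by []. Qed.
Lemma inlK (A B : Type) : ocancel (@get_inl A B) (@inl A B). Proof. by case. Qed.
Lemma inrK (A B : Type) : ocancel (@get_inr A B) (@inr A B). Proof. by case. Qed.

Definition comp_prog : prog I S :=
  pseq (lift inl (@get_inl _ _) inl (@get_inl _ _) (prog_of M))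
    (pseq (copy_output S (inl ord_max : I) (inr ord0))
      (lift inr (@get_inr _ _) inr (@get_inr _ _) (prog_of N))).

(** [split] places the tapes of [M] before those of [N], so the first tape is the input of [M] and
    the last one the output of [N]. *)
Definition comp_tm : tm :=
  @tm_of I S (tm_tapes M + (tm_tapes N).+1) (@split (tm_tapes M).+1 (tm_tapes N).+1)
    (@unsplit (tm_tapes M).+1 (tm_tapes N).+1) comp_prog.

Lemma foutput_ftmap (T T' : finType) (g : T -> T') (t : ftape T) y :
  foutput (ftmap g t) y <-> foutput t y.
Proof.
rewrite /foutput /=; split=> -[h h']; split.
- by move=> i /h; case: (t.2 i) => [[c|s]|] //= [->].
- by move=> c E; apply: (h' c); rewrite E.
- by move=> i /h ->.
- by move=> c E; apply: (h' c); case: (t.2 _) E => [[c'|s]|] //= [->].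
Qed.

(** Copying and rewinding cost [2 * size y + 2] steps, the two handovers one step each. *)
Lemma comp_tmP x t1 y t2 z :
  outputs_within M x t1 y -> outputs_within N y t2 z ->
  outputs_within comp_tm x (t1 + t2 + 2 * size y + 4) z.
Proof.
move=> /outputs_withinP[tp1 h1 o1] /outputs_withinP[tp2 h2 o2].
apply/outputs_withinP.
pose tp0 (i : I) : ftape S :=
  match i with inl j => finput S x j | inr _ => fblank S end.
have tp0E j : tp0 (inl j) = ftmap inl (finput (tm_symbol M) x j).
  by rewrite /tp0 /finput; case: eqP => _ //; rewrite ftmap_stack.
have {}h1 := reach_lift (@get_inlK _ _) (@inlK _ _) (@get_inlK _ _) tp0E h1.
set tp1' := (X in reach _ _ _ X) in h1.
have [|| tp3 h3 [tp3b tp3i]] := @reach_copy_output I S (inl ord_max) (inr ord0) isT tp1' y.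
- by [].
- exact/foutput_ftmap.
have tp3E j : tp3 (inr j) = ftmap inr (finput (tm_symbol N) y j).
  rewrite /finput; case: eqP => [->|/eqP nj]; first by rewrite tp3b ftmap_stack.
  by rewrite tp3i.
have {}h2 := reach_lift (@get_inrK _ _) (@inrK _ _) (@get_inrK _ _) tp3E h2.
have h := reach_seq h1 (reach_seq h3 h2).
exists ((fun i : I => if get_inr i is Some j then ftmap inr (tp2 j) else tp3 i) \o
        @split (tm_tapes M).+1 (tm_tapes N).+1); last first.
  rewrite /=.
  have -> : (ord_max : 'I_(tm_tapes M + (tm_tapes N).+1).+1) =
            rshift (tm_tapes M).+1 (ord_max : 'I_(tm_tapes N).+1).
    by apply: val_inj => /=; rewrite addnS addSn.
  by rewrite (unsplitK (inr _)) /=; apply/foutput_ftmap.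
have -> : finput (tm_symbol comp_tm) x = tp0 \o @split (tm_tapes M).+1 (tm_tapes N).+1.
  apply: funext => i; rewrite /finput /=.
  case: splitP => [j ij|j ij] /=.
    by rewrite /finput -!val_eqE /= ij.
  by rewrite -val_eqE /= ij.
apply: (@reach_tm_of I S _ _ _ (@unsplitK (tm_tapes M).+1 (tm_tapes N).+1)).
apply: reach_le h; lia.
Qed.

Lemma size_run x t i : size ((run t (init M x)).2 i).2 <= size x + t + 1.
Proof.
elim: t => [|t]; rewrite /run /=.
  by case: ifP => _ //; rewrite size_map addn0 leq_addr.
rewrite /Defs.next; case: (iter t _ _) => q tp /=; case: tm_trans => [[q' a]|] /= IH.
  move: IH; case: (tp i) => [l r] /=; case: (a i) => s [] /= h; rewrite ?size_behead; lia.
by apply: leq_trans IH _; rewrite leq_add2r leq_add2l.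
Qed.

(** Bounds the intermediate word of a composition, and thereby the running time of the second
    machine. *)
Lemma output_size x t y : outputs_within M x t y -> size y <= size x + t + 1.
Proof.
move=> [_ <-]; apply: leq_trans (size_run x t ord_max); rewrite /output.
by elim: (_.2) => //= -[[c|?]|] s.
Qed.

End Composition.

(** * Programs on stack registers *)

Section Registers.
Variable k : nat.
Let I := 'I_k.+1.
Implicit Types (st : I -> seq bool) (r o : I).

Notation prog := (prog I void).
Notation computes := (@computes I void).

Definition loop (r : I) (A1 A0 : prog) : prog := branch true r A1 A0.

Lemma computes_le A st t t' st' : t <= t' -> computes A st t st' -> computes A st t' st'.
Proof. exact: reach_le. Qed.

(** The last bit is pushed first, so the word reads forwards from the top. All output is thus
    produced from its end. *)
Fixpoint push_word (w : seq bool) (r : I) : prog :=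
  if w is b :: w' then pseq (push_word w' r) (push _ b r) else skip I void.

Lemma computes_push_word w r st :
  computes (push_word w r) st (3 * size w) (upd st r (w ++ st r)).
Proof.
elim: w => [|b w IHw] /=; first by rewrite upd_id; apply: reach_skip.
have := computes_seq IHw (computes_push _ b r _).
rewrite upd_upd upd_same; apply: computes_le; lia.
Qed.

Definition move_rev (r o : I) : prog := loop r (push _ true o) (push _ false o).

Lemma computes_move_rev r o st : r != o ->
  computes (move_rev r o) st (4 * size (st r))
    (upd (upd st r [::]) o (rev (st r) ++ st o)).
Proof.
move=> ro; have or : o != r by rewrite eq_sym.
move: {2}(st r) (erefl (st r)) => s; elim: s st => [|b s IHs] st er.
  have -> : upd (upd st r [::]) o (rev (st r) ++ st o) = st.
    by apply: funext => i; rewrite /upd er; case: eqP => [->|_] //; case: eqP => [->|].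
  by rewrite er muln0; apply: computes_branch_nil.
rewrite er rev_cons cat_rcons.
have h : computes (if b then push _ true o else push _ false o) (upd st r s) 2
    (upd (upd st r s) o (b :: st o)).
  have -> : (if b then push _ true o else push _ false o) = push void b o by case: b {er}.
  by have := computes_push void b o (upd st r s); rewrite (upd_neq _ _ or).
set st1 := upd _ o _ in h.
have st1r : st1 r = s by rewrite /st1 /upd (negPf ro) eqxx.
have := computes_loop er h (IHs st1 st1r); rewrite st1r.
have -> : upd (upd st1 r [::]) o (rev s ++ st1 o) = upd (upd st r [::]) o (rev s ++ b :: st o).
  apply: funext => i; rewrite /st1 /upd eqxx.
  by case: eqP => // _; case: eqP.
by apply: computes_le => /=; lia.
Qed.

Definition subst_word (w1 w0 s : seq bool) : seq bool :=
  flatten [seq if b then w1 else w0 | b <- s].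

Variable tmp : I.

Definition copy_back (r o : I) (w1 w0 : seq bool) : prog :=
  loop tmp (pseq (push_word w1 o) (push _ true r)) (pseq (push_word w0 o) (push _ false r)).

Lemma computes_copy_back r o w1 w0 st : r != tmp -> o != tmp -> r != o ->
  computes (copy_back r o w1 w0) st ((3 * size w1 + 3 * size w0 + 5) * size (st tmp))
    (upd (upd (upd st tmp [::]) r (rev (st tmp) ++ st r)) o
       (subst_word w1 w0 (rev (st tmp)) ++ st o)).
Proof.
move=> rt ot ro; move: {2}(st tmp) (erefl (st tmp)) => s; elim: s st => [|b s IHs] st er.
  rewrite er muln0.
  have -> : upd (upd (upd st tmp [::]) r (rev [::] ++ st r)) o ([::] ++ st o) = st.
    by apply: funext => i; rewrite /upd; do 3![case: eqP => [->|_] //].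
  exact: computes_branch_nil.
pose w := if b then w1 else w0.
have h : computes (if b then pseq (push_word w1 o) (push _ true r)
                   else pseq (push_word w0 o) (push _ false r)) (upd st tmp s)
    (3 * size w1 + 3 * size w0 + 3)
    (upd (upd (upd st tmp s) o (w ++ st o)) r (b :: st r)).
  have -> : (if b then pseq (push_word w1 o) (push _ true r)
             else pseq (push_word w0 o) (push _ false r)) =
            pseq (push_word w o) (push _ b r) by rewrite /w; case: (b).
  have := computes_seq (computes_push_word w o (upd st tmp s)) (computes_push _ b r _).
  rewrite (upd_neq _ _ ot) (upd_neq _ _ ro) (upd_neq _ _ rt).
  by apply: computes_le; rewrite /w; case: (b); lia.
set st1 := upd _ r _ in h.
have st1t : st1 tmp = s by rewrite /st1 /upd !(eq_sym tmp) (negPf rt) (negPf ot) eqxx.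
have := computes_loop er h (IHs st1 st1t); rewrite st1t.
have -> : upd (upd (upd st1 tmp [::]) r (rev s ++ st1 r)) o
     (subst_word w1 w0 (rev s) ++ st1 o) =
   upd (upd (upd st tmp [::]) r (rev (st tmp) ++ st r)) o
     (subst_word w1 w0 (rev (st tmp)) ++ st o).
  rewrite er rev_cons cat_rcons /subst_word map_rcons flatten_rcons -catA.
  apply: funext => i; rewrite /st1 /upd !eqxx (eq_sym o r) (negPf ro).
  by case: eqP => // _; case: eqP => // _; case: eqP.
by apply: computes_le => /=; rewrite er /=; lia.
Qed.

(** A stack can only be read by emptying it. The detour through [tmp] restores [r], and as the bits
    come back last first, their words are pushed in the right order. *)
Definition copy_subst (r o : I) (w1 w0 : seq bool) : prog :=
  pseq (move_rev r tmp) (copy_back r o w1 w0).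

Definition word_cost (w1 w0 : seq bool) := 3 * size w1 + 3 * size w0 + 9.

Lemma computes_copy_subst r o w1 w0 st : r != tmp -> o != tmp -> r != o -> st tmp = [::] ->
  computes (copy_subst r o w1 w0) st (word_cost w1 w0 * (size (st r)).+1)
    (upd st o (subst_word w1 w0 (st r) ++ st o)).
Proof.
move=> rt ot ro st0.
have := computes_seq (computes_move_rev st rt) (computes_copy_back w1 w0 _ rt ot ro).
rewrite upd_same st0 cats0 revK size_rev.
set st1 := upd st o _; set st2 := upd _ o _.
have -> : st2 = st1.
  apply: funext => i; rewrite /st1 /st2 /upd eqxx (negPf rt) (negPf ot) (eq_sym o r) (negPf ro).
  case: eqP => // _; case: eqP => [->|_]; first by rewrite cats0.
  by case: eqP => // ->.
by apply: computes_le; rewrite /word_cost; lia.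
Qed.

(* The instructions of a right-to-left emitter: a constant word, or a register
   with every bit replaced by one of two words. *)
Definition emit : Type := (seq bool + I * (seq bool * seq bool))%type.

Definition emit_word st (e : emit) : seq bool :=
  match e with inl w => w | inr (r, (w1, w0)) => subst_word w1 w0 (st r) end.

Definition emit_words st (es : seq emit) : seq bool := flatten [seq emit_word st e | e <- es].

Definition emit_ok (o : I) (e : emit) : bool :=
  if e is inr (r, _) then (r != tmp) && (r != o) else true.

Definition emit_cost (e : emit) : nat :=
  match e with inl w => 3 * size w | inr (r, (w1, w0)) => word_cost w1 w0 end.

Definition emits_cost (es : seq emit) : nat := sumn [seq (emit_cost e).+1 | e <- es].

Definition emit_prog (o : I) (e : emit) : prog :=
  match e with inl w => push_word w o | inr (r, (w1, w0)) => copy_subst r o w1 w0 end.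

Definition emits (o : I) (es : seq emit) : prog :=
  foldr (fun e P => pseq P (emit_prog o e)) (skip I void) es.

Lemma emit_words_upd o es st v : all (emit_ok o) es ->
  emit_words (upd st o v) es = emit_words st es.
Proof.
move=> /allP h; congr flatten; apply/eq_in_map => -[w|[r [w1 w0]]] //= /h /=.
by move=> /andP[_ ro]; rewrite upd_neq.
Qed.

Lemma computes_emits o es st B : o != tmp -> st tmp = [::] -> all (emit_ok o) es ->
  (forall i, i != o -> size (st i) <= B) ->
  computes (emits o es) st (emits_cost es * B.+1) (upd st o (emit_words st es ++ st o)).
Proof.
move=> ot st0 + leB; elim: es => [|e es IHes] /=; first by rewrite upd_id => _; apply: reach_skip.
move=> /andP[ok oks]; have {}IHes := IHes oks; set st1 := upd st o _ in IHes.
suff h : computes (emit_prog o e) st1 (emit_cost e * B.+1)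
    (upd st1 o (emit_word st e ++ st1 o)).
  have := computes_seq IHes h; rewrite /st1 upd_upd upd_same catA.
  by apply: computes_le; rewrite /emits_cost /=; nia.
case: e ok => [w|[r [w1 w0]]] /=.
  by move=> _; apply: computes_le (computes_push_word _ _ _); rewrite leq_pmulr.
move=> /andP[rt ro].
have rE : st1 r = st r by rewrite /st1 upd_neq.
have := computes_copy_subst w1 w0 (st := st1) rt ot ro; rewrite rE.
have -> : st1 tmp = [::] by rewrite /st1 upd_neq // eq_sym.
move=> /(_ erefl); apply: computes_le; rewrite leq_pmul2l ?ltnS ?leB //.
by rewrite /word_cost; lia.
Qed.

Definition emit_loop (c o : I) (es : seq emit) : prog := loop c (emits o es) (emits o es).

(** The counter can be read by the body: when [m] bits are left on it, block [m] is emitted. Indices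
    decrease while each block lands on top of the previous one, so the blocks end up in increasing
    order. *)
Lemma computes_emit_loop c o es st B N : o != tmp -> c != tmp -> c != o ->
  st tmp = [::] -> all (emit_ok o) es -> (forall i, i != o -> size (st i) <= B) ->
  st c = nseq N true ->
  computes (emit_loop c o es) st (N * (emits_cost es * B.+1 + 2))
    (upd (upd st c [::]) o
      (flatten [seq emit_words (upd st c (nseq m true)) es | m <- iota 0 N] ++ st o)).
Proof.
move=> ot ct co st0 ok leB; elim: N st st0 leB => [|N IHN] st st0 leB eN.
  have -> : upd (upd st c [::]) o
      (flatten [seq emit_words (upd st c (nseq m true)) es | m <- iota 0 0] ++ st o) = st.
    by apply: funext => i; rewrite /upd; do 2![case: eqP => [->|_] //].
  exact: computes_branch_nil.
set st1 := upd st c (nseq N true).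
have st1t : st1 tmp = [::] by rewrite /st1 upd_neq // eq_sym.
have leB1 i : i != o -> size (st1 i) <= B.
  move=> io; rewrite /st1 /upd; case: eqP => [ic|_]; last exact: leB.
  by have := leB _ co; rewrite eN !size_nseq => /ltnW.
have h := computes_emits ot st1t ok leB1.
have {}h : computes (if true then emits o es else emits o es) (upd st c (nseq N true))
    (emits_cost es * B.+1) (upd st1 o (emit_words st1 es ++ st1 o)) by [].
set st2 := upd st1 o _ in h.
have st2c : st2 c = nseq N true by rewrite /st2 upd_neq // /st1 upd_same.
have st2t : st2 tmp = [::] by rewrite /st2 upd_neq // eq_sym.
have leB2 i : i != o -> size (st2 i) <= B by move=> io; rewrite /st2 upd_neq // leB1.
have := computes_loop eN h (IHN _ st2t leB2 st2c).
have -> : iota 0 N.+1 = rcons (iota 0 N) N by rewrite -addn1 iotaD cats1.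
rewrite map_rcons flatten_rcons -catA -/st1.
have -> : st2 o = emit_words st1 es ++ st o by rewrite /st2 upd_same /st1 upd_neq // eq_sym.
have -> : [seq emit_words (upd st2 c (nseq m true)) es | m <- iota 0 N] =
          [seq emit_words (upd st c (nseq m true)) es | m <- iota 0 N].
  apply: eq_map => m; have -> : upd st2 c (nseq m true) =
      upd (upd st c (nseq m true)) o (st2 o).
    apply: funext => i; rewrite /st2 /st1 /upd eqxx.
    by case: (i =P c) => [->|//]; rewrite (negPf co).
  by rewrite emit_words_upd.
have -> (v : seq bool) : upd (upd st2 c [::]) o v = upd (upd st c [::]) o v.
  by apply: funext => i; rewrite /st2 /st1 /upd; do 2![case: eqP => //].
by apply: computes_le; lia.
Qed.

(** * Evaluating polynomials in unary *)

Section Horner.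
Variables x acc acc2 : I.
Hypotheses (xt : x != tmp) (at0 : acc != tmp) (a2t : acc2 != tmp).
Hypotheses (xa : x != acc) (xa2 : x != acc2) (aa2 : acc != acc2).

Definition mul_prog : prog :=
  loop acc (copy_subst x acc2 [:: true] [:: true]) (copy_subst x acc2 [:: true] [:: true]).

Lemma subst_word_unary s : subst_word [:: true] [:: true] s = nseq (size s) true.
Proof. by elim: s => //= b s IHs; rewrite /subst_word /= -/(subst_word _ _ _) IHs; case: b. Qed.

Lemma computes_mul st m : st tmp = [::] -> st acc = nseq m true ->
  computes mul_prog st (m * (15 * (size (st x)).+1 + 2))
    (upd (upd st acc [::]) acc2 (nseq (m * size (st x)) true ++ st acc2)).
Proof.
elim: m st => [|m IHm] st st0 sta.
  have -> : upd (upd st acc [::]) acc2 (nseq (0 * size (st x)) true ++ st acc2) = st.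
    by apply: funext => i; rewrite /upd; do 2![case: eqP => [->|_] //].
  exact: computes_branch_nil.
set st1 := upd st acc (nseq m true).
have st1t : st1 tmp = [::] by rewrite /st1 upd_neq // eq_sym.
have h := computes_copy_subst [:: true] [:: true] xt a2t xa2 st1t.
have st1x : st1 x = st x by rewrite /st1 upd_neq.
have st1a2 : st1 acc2 = st acc2 by rewrite /st1 upd_neq // eq_sym.
rewrite subst_word_unary st1x st1a2 in h; set st2 := upd st1 acc2 _ in h.
have {}h : computes (if true then copy_subst x acc2 [:: true] [:: true]
    else copy_subst x acc2 [:: true] [:: true]) (upd st acc (nseq m true))
    (15 * (size (st x)).+1) st2 by [].
have st2a : st2 acc = nseq m true by rewrite /st2 upd_neq // /st1 upd_same.
have st2t : st2 tmp = [::] by rewrite /st2 upd_neq // eq_sym.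
have st2x : st2 x = st x by rewrite /st2 upd_neq // st1x.
have := computes_loop sta h (IHm _ st2t st2a); rewrite st2x.
have -> : st2 acc2 = nseq (size (st x)) true ++ st acc2 by rewrite /st2 upd_same.
have -> (v : seq bool) : upd (upd st2 acc [::]) acc2 v = upd (upd st acc [::]) acc2 v.
  by apply: funext => i; rewrite /st2 /st1 /upd; do 2![case: eqP => //].
by rewrite catA -nseqD -mulSnr; apply: computes_le; lia.
Qed.

(** The argument is the length of register [x], whatever its bits. Each round builds the product on
    [acc2], moves it back to [acc] and adds the coefficient. *)
Fixpoint horner_prog (cs : seq nat) : prog :=
  if cs is c :: cs' then
    pseq (horner_prog cs') (pseq mul_prog (pseq (move_rev acc2 acc)
      (push_word (nseq c true) acc)))
  else skip I void.

Fixpoint horner_cost (cs : seq nat) (n : nat) : nat :=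
  if cs is c :: cs' then
    horner_cost cs' n + horner_rec cs' n * (15 * n + 17) + 4 * (horner_rec cs' n * n)
    + 3 * c + 3
  else 0.

Lemma computes_horner cs st : st tmp = [::] -> st acc = [::] -> st acc2 = [::] ->
  computes (horner_prog cs) st (horner_cost cs (size (st x)))
    (upd st acc (nseq (horner_rec cs (size (st x))) true)).
Proof.
move=> st0 sta sta2; elim: cs => [|c cs IHcs] /=.
  by rewrite -sta upd_id; apply: reach_skip.
set n := size (st x) in IHcs *; set m := horner_rec cs n in IHcs *.
set st1 := upd st acc _ in IHcs.
have st1t : st1 tmp = [::] by rewrite /st1 upd_neq // eq_sym.
have st1x : st1 x = st x by rewrite /st1 upd_neq.
have := computes_mul st1t (upd_same st acc (nseq m true)); rewrite st1x -/n.
have -> : st1 acc2 = [::] by rewrite /st1 upd_neq // eq_sym.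
rewrite cats0 /st1 upd_upd; set st2 := upd _ acc2 _ => hmul.
have a2a : acc2 != acc by rewrite eq_sym.
have := computes_move_rev st2 a2a.
have -> : st2 acc2 = nseq (m * n) true by rewrite /st2 upd_same.
have -> : st2 acc = [::] by rewrite /st2 upd_neq // upd_same.
have -> : rev (nseq (m * n) true) = nseq (m * n) true.
  elim: (_ * _) => //= j IHj; rewrite rev_cons IHj.
  by elim: j {IHj} => //= j ->.
rewrite cats0 size_nseq; set st3 := upd _ acc _ => hmove.
have := computes_push_word (nseq c true) acc st3.
have -> : st3 acc = nseq (m * n) true by rewrite /st3 upd_same.
rewrite -nseqD size_nseq; set st4 := upd _ acc _ => hpush.
have -> : upd st acc (nseq (m * n + c)%R true) = st4.
  apply: funext => i; rewrite /st4 /st3 /st2 /upd; case: eqP => // _; first by rewrite addnC.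
  by case: eqP => // ->.
by apply: computes_le (computes_seq IHcs (computes_seq hmul (computes_seq hmove hpush))); lia.
Qed.

End Horner.

End Registers.

(** * Polynomial time *)

Definition reg_tm k (A : prog 'I_k.+1 void) : tm := tm_of id id A.

Definition reg_input k (x : seq bool) (i : 'I_k.+1) : seq bool :=
  if i == ord0 then x else [::].

Lemma reg_tmP k (A : prog 'I_k.+1 void) x t st' :
  computes A (reg_input x) t st' -> outputs_within (reg_tm A) x t (st' ord_max).
Proof.
move=> h; apply/outputs_withinP; exists (stacks void st' \o id).
  have -> : finput (tm_symbol (reg_tm A)) x = stacks void (reg_input x) \o id :> ('I_k.+1 -> _).
    apply: funext => i; rewrite /finput /stacks /reg_input /=.
    by case: eqP => // _; rewrite stack_nil.
  by apply: reach_tm_of.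
rewrite /foutput /stacks /=; split=> [i lti|c]; first by rewrite (nth_map false).
by rewrite nth_default ?size_map.
Qed.

Lemma outputs_within_le M x t t' y :
  t <= t' -> outputs_within M x t y -> outputs_within M x t' y.
Proof.
move=> le /outputs_withinP[tp h o]; apply/outputs_withinP; exists tp => //.
exact: reach_le h.
Qed.

(** With coefficients in [nat], a time bound evaluated at an upper bound of the length is again a
    time bound. *)
Lemma horner_nat_mono (p : {poly nat}) : {homo horner p : m n / (m <= n)%N}.
Proof.
move=> m n le; rewrite /horner; elim: (polyseq p) => //= a s IHs.
by rewrite leq_add2r leq_mul.
Qed.

Definition poly_bounded (f : nat -> nat) :=
  exists p : {poly nat}, forall n, (f n <= p.[n]%R)%N.

Lemma poly_bounded_le f g : (forall n, f n <= g n) -> poly_bounded g -> poly_bounded f.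
Proof. by move=> le [p hp]; exists p => n; apply: leq_trans (le n) (hp n). Qed.

Lemma poly_bounded_horner (p : {poly nat}) : poly_bounded (fun n => p.[n]%R).
Proof. by exists p. Qed.

Lemma poly_bounded_id : poly_bounded id.
Proof. by exists 'X%R => n; rewrite hornerX. Qed.

Lemma poly_bounded_const c : poly_bounded (fun=> c).
Proof. by exists (c%:P)%R => n; rewrite hornerC. Qed.

Lemma poly_bounded_add f g :
  poly_bounded f -> poly_bounded g -> poly_bounded (fun n => f n + g n).
Proof.
move=> [p hp] [q hq]; exists (p + q)%R => n.
by rewrite hornerD; apply: leq_add.
Qed.

Lemma poly_bounded_mul f g :
  poly_bounded f -> poly_bounded g -> poly_bounded (fun n => f n * g n).
Proof.
move=> [p hp] [q hq]; exists (p * q)%R => n.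
by rewrite hornerM; apply: leq_mul.
Qed.

Lemma poly_bounded_horner_rec cs : poly_bounded (horner_rec cs).
Proof.
elim: cs => [|c cs IHcs] /=; first exact: (poly_bounded_const 0).
apply: poly_bounded_add; last exact: poly_bounded_const.
exact: poly_bounded_mul poly_bounded_id.
Qed.

Ltac poly_bound := repeat first
  [ exact: poly_bounded_id | exact: poly_bounded_const | exact: poly_bounded_horner
  | exact: poly_bounded_horner_rec | assumption
  | apply: poly_bounded_add | apply: poly_bounded_mul ].

Lemma poly_bounded_horner_cost cs : poly_bounded (horner_cost cs).
Proof. by elim: cs => [|c cs IHcs] /=; [exact: (poly_bounded_const 0) | poly_bound]. Qed.

Lemma polytime_solvableI (I : Type) (code : I -> seq bool) good (M : tm) f :
  poly_bounded f ->
  (forall a, exists y, outputs_within M (code a) (f (size (code a))) y /\ good a y) ->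
  polytime_solvable code good.
Proof.
move=> [p hp] h; exists M, p => a; have [y [o g]] := h a.
by exists y; split=> //; apply: outputs_within_le o.
Qed.

(** The second machine promises nothing on words that are not codes, so every acceptable first
    answer has to be the code of some instance [b], which may depend on that answer. *)
Lemma polytime_solvable_comp (I J : Type) (code1 : I -> seq bool) good1
    (code2 : J -> seq bool) good2 good :
  polytime_solvable code1 good1 -> polytime_solvable code2 good2 ->
  (forall a y, good1 a y -> exists2 b, y = code2 b & forall z, good2 b z -> good a z) ->
  polytime_solvable code1 good.
Proof.
move=> [M [p hM]] [N [q hN]] h.
(* The length of the intermediate word, from [output_size]. *)
pose s : {poly nat} := ('X + p + 1)%R.
apply: (@polytime_solvableI _ _ _ (comp_tm M N)
  (fun n => p.[n]%R + (q \Po s).[n]%R + 2 * s.[n]%R + 4)); first by poly_bound.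
move=> a; have [y [oM gy]] := hM a; have [b yb hb] := h a y gy.
have [z [oN gz]] := hN b; rewrite -yb in oN.
have sE : size y <= s.[size (code1 a)]%R.
  by apply: leq_trans (output_size oM) _; rewrite !hornerE.
exists z; split; last exact: hb.
apply: outputs_within_le (comp_tmP oM oN).
rewrite leq_add2r; apply: leq_add; last by rewrite leq_mul2l.
by rewrite leq_add2l horner_comp horner_nat_mono.
Qed.

(** * Two small machines, and P inside NP *)

Definition tape0 : 'I_3 := ord0.
Definition tape1 : 'I_3 := @Ordinal 3 1 isT.
Definition tape2 : 'I_3 := ord_max.

(** [tape2] always holds one bit, the answer so far; the inner loop removes it before [true] is
    pushed. *)
Definition has_true_prog : prog 'I_3 void :=
  pseq (push _ false tape2)
    (loop tape0 (pseq (loop tape2 (skip _ _) (skip _ _)) (push _ true tape2)) (skip _ _)).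

Lemma has_true_polytime : polytime_solvable id (fun y z => z = [:: true \in y]).
Proof.
apply: (@polytime_solvableI _ _ _ (reg_tm has_true_prog) (fun n => 8 * n + 3)); first by poly_bound.
move=> y; exists [:: true \in y]; split=> //.
suff h st : size (st tape2) = 1 -> st tape0 = y -> exists2 st',
    computes (loop tape0 (pseq (loop tape2 (skip _ _) (skip _ _)) (push _ true tape2)) (skip _ _))
    st (8 * size y) st' & st' tape2 = if true \in y then [:: true] else st tape2.
  have [//|//|st' hst' e] := h (upd (reg_input y) tape2 [:: false]).
  have := reg_tmP (computes_seq (computes_push _ false tape2 (reg_input y)) hst').
  rewrite -/tape2 e upd_same; case: (true \in y); apply: outputs_within_le; lia.
elim: y st => [|b y IHy] st s1 s0.
  by exists st => //; apply: computes_branch_nil.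
case: b s0 => s0.
- case E: (st tape2) s1 => [|c []] // _.
  have E' : upd st tape0 y tape2 = [:: c] by rewrite upd_neq.
  have h1 : computes (loop tape2 (skip _ _) (skip _ _)) (upd st tape0 y) 2
      (upd (upd st tape0 y) tape2 [::]).
    apply: (computes_loop E' (t1 := 0)); first by case: (c); apply: reach_skip.
    by apply: computes_branch_nil; rewrite upd_same.
  have h2 := computes_seq h1 (computes_push _ true tape2 _).
  rewrite upd_upd upd_same in h2.
  have [|| st' h' e] := IHy (upd (upd st tape0 y) tape2 [:: true]).
  - by rewrite upd_same.
  - by rewrite upd_neq // upd_same.
  exists st'; last by rewrite e upd_same in_cons eqxx; case: ifP.
  apply: computes_le (computes_loop s0 h2 h'); rewrite /=; lia.
- have [|| st' h' e] := IHy (upd st tape0 y).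
  - by rewrite upd_neq.
  - by rewrite upd_same.
  exists st'; last by rewrite e upd_neq.
  apply: computes_le (computes_loop s0 (t1 := 0) _ h'); first by rewrite /=; lia.
  exact: reach_skip.
Qed.

(** Inverts [delimit], whose codes have odd length: the terminating [false] is left alone and
    dropped. *)
Fixpoint odds (z : seq bool) : seq bool :=
  if z is _ :: b :: z' then b :: odds z' else [::].

Definition pop_push : prog 'I_3 void := branch false tape0 (push _ true tape1) (push _ false tape1).

Definition odds_prog : prog 'I_3 void :=
  pseq (loop tape0 pop_push pop_push) (move_rev tape1 tape2).

Lemma odds_polytime : polytime_solvable id (fun z y => y = odds z).
Proof.
apply: (@polytime_solvableI _ _ _ (reg_tm odds_prog) (fun n => 10 * n + 1)); first by poly_bound.
move=> z; exists (odds z); split=> //.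
suff h st n : size z <= n -> st tape0 = z -> exists2 st',
    computes (loop tape0 pop_push pop_push) st (6 * size z) st' &
    st' tape1 = rev (odds z) ++ st tape1 /\ st' tape2 = st tape2.
  have [//|st' hst' [e1 e2]] := h (reg_input z) _ (leqnn _).
  have := reg_tmP (computes_seq hst' (computes_move_rev st' (isT : tape1 != tape2))).
  rewrite -/tape2 upd_same e1 e2 !cats0 revK size_rev; apply: outputs_within_le.
  have : size (odds z) <= size z; last by lia.
  elim: (size z) {1 3}z (leqnn (size z)) => [|m IHm] [|a [|b z']] //= le.
  by have := IHm z' (ltnW le); lia.
elim: n z st => [|n IHn] [|a [|b z]] st //= le s0.
- by exists st => //; apply: computes_branch_nil.
- by exists st => //; apply: computes_branch_nil.
- exists (upd st tape0 [::]); last by rewrite !upd_neq.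
  have h1 : computes (if a then pop_push else pop_push) (upd st tape0 [::]) 0 (upd st tape0 [::]).
    by case: (a); apply: computes_branch_nil; rewrite upd_same.
  apply: computes_le (computes_loop s0 h1 (t2 := 0) _) => //.
  by apply: computes_branch_nil; rewrite upd_same.
- set st1 := upd st tape0 (b :: z).
  set st2 := upd (upd st tape0 z) tape1 (b :: st tape1).
  have h1 : computes (if a then pop_push else pop_push) st1 3 st2.
    have -> : (if a then pop_push else pop_push) = pop_push by case: (a).
    apply: (computes_if (upd_same _ _ _)); rewrite upd_upd.
    have -> : (if b then push _ true tape1 else push _ false tape1) = push void b tape1 by case: (b).
    by have := computes_push void b tape1 (upd st tape0 z); rewrite (upd_neq st).
  have [||st' h' [e1 e2]] := IHn z st2; first exact: ltnW.
    by rewrite /st2 upd_neq // upd_same.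
  exists st'; last by rewrite e1 e2 /st2 upd_same rev_cons cat_rcons !upd_neq.
  by apply: computes_le (computes_loop s0 h1 h'); lia.
Qed.

Lemma odds_delimit x : odds (delimit x) = x.
Proof. by rewrite /delimit; elim: x => //= b x ->. Qed.

(** The bound 0 leaves only the empty certificate, for which the pair code is [delimit x]; the
    verifier decodes it and decides [L]. *)
Lemma inP_inNP (L : language) : inP L -> inNP L.
Proof.
move=> hL; exists (L \o odds), 0%R; split.
  apply: (polytime_solvable_comp odds_polytime hL) => z _ ->.
  by exists (odds z).
move=> x; rewrite horner0; split=> [Lx|[u []]].
  by exists [::]; rewrite /pair_code /= cats0 odds_delimit.
by rewrite leqn0 => /nilP->; rewrite /pair_code /= cats0 odds_delimit.
Qed.

(** * Binary numbers *)

Definition bits (w n : nat) : seq bool := mkseq (fun i => odd (n %/ 2 ^ i)) w.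

Definition bits_value (s : seq bool) : nat := foldr (fun (b : bool) v => b + v.*2) 0 s.

Lemma bits_value_cat s1 s2 :
  bits_value (s1 ++ s2) = bits_value s1 + 2 ^ size s1 * bits_value s2.
Proof.
elim: s1 => [|b s1 IHs] /=; first by rewrite mul1n.
by rewrite IHs expnS; lia.
Qed.

Lemma bits_value_zeros n : bits_value (nseq n false) = 0.
Proof. by elim: n => //= n ->. Qed.

Lemma size_bits w n : size (bits w n) = w.
Proof. exact: size_mkseq. Qed.

Lemma bits_recl w n : bits w.+1 n = odd n :: bits w n./2.
Proof.
rewrite /bits /mkseq /= expn0 divn1; congr cons.
rewrite (iotaDl 1 0) -map_comp; apply: eq_map => i /=.
by rewrite add1n expnS divnMA divn2.
Qed.

Lemma bits_value_bits w n : n < 2 ^ w -> bits_value (bits w n) = n.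
Proof.
elim: w n => [|w IHw] n; first by rewrite expn0 ltnS leqn0 => /eqP->.
rewrite bits_recl /= expnS => lt; rewrite IHw ?odd_double_half //.
by have := odd_double_half n; lia.
Qed.

Lemma bits_bits_value s : bits (size s) (bits_value s) = s.
Proof.
elim: s => // b s IHs; rewrite /= bits_recl oddD odd_double addbF oddb.
by rewrite half_bit_double IHs.
Qed.

Lemma bits_value_lt s : bits_value s < 2 ^ size s.
Proof. by elim: s => //= b s IHs; rewrite expnS; case: b; lia. Qed.

(** The default [true] admits the empty word, which represents 0; otherwise the top bit must be set.
    This identifies an explicitly given word as the binary form of its value. *)
Lemma binary_bits_value s : last true s -> binary (bits_value s) = s.
Proof.
move=> ls; rewrite /binary -/(bits _ _) -{3}[s]bits_bits_value; congr bits.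
case: (lastP s) ls => [|s' b]; first by rewrite up_log1.
rewrite last_rcons size_rcons => ->; apply: up_log_eq => //.
rewrite ltnS -cats1 bits_value_cat /= muln1 leq_addl /=.
by rewrite expnS; have := bits_value_lt s'; lia.
Qed.

Lemma binaryK n : bits_value (binary n) = n.
Proof. by apply: bits_value_bits; apply: up_logP. Qed.

Lemma last_binary b n : 0 < n -> last b (binary n) = true.
Proof.
move=> n0; rewrite /binary -/(bits _ _).
set w := up_log 2 n.+1; have w0 : 0 < w by rewrite up_log_gt0 // ltnS.
rewrite -nth_last size_bits nth_mkseq ?prednK //.
have lt : 2 ^ w.-1 < n.+1 by apply: up_log_gtn; rewrite ?ltnS.
have gt : n < 2 ^ w by apply: up_logP.
rewrite -(prednK w0) expnS in gt.
have -> : n %/ 2 ^ w.-1 = 1; last by [].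
by apply/eqP; rewrite eqn_leq -ltnS ltn_divLR ?leq_divRL ?expn_gt0 // gt mul1n.
Qed.

Lemma digit_eq b x y x' y' : x < b -> y < b ->
  x + b * x' = y + b * y' -> x = y /\ x' = y'.
Proof.
move=> xb yb e; have b0 : 0 < b by apply: leq_ltn_trans xb.
have e1 : x = y.
  by rewrite -(modn_small xb) -(modn_small yb) -(modnMDl x' x b) -(modnMDl y' y b);
     congr (_ %% _); lia.
split=> //; apply/eqP; rewrite -(eqn_pmul2l b0); apply/eqP; lia.
Qed.

Lemma digits_eq b n (d e : nat -> nat) :
  (forall k, k < n -> d k < b) -> (forall k, k < n -> e k < b) ->
  \sum_(k < n) b ^ k * d k = \sum_(k < n) b ^ k * e k ->
  forall k, k < n -> d k = e k.
Proof.
elim: n d e => // n IHn d e db eb; rewrite !big_ord_recl !expn0 !mul1n.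
have shift f : \sum_(i < n) b ^ bump 0 i * f (bump 0 i) = b * \sum_(i < n) b ^ i * f i.+1.
  by rewrite big_distrr; apply: eq_bigr => i _; rewrite /= /bump /= add1n expnS mulnA.
rewrite !shift => /(digit_eq (db 0 isT) (eb 0 isT))[e0 e1] [|k] // ltk.
exact: (IHn (fun k => d k.+1) (fun k => e k.+1) (fun k h => db k.+1 h) (fun k h => eb k.+1 h)).
Qed.

(** * From subset sum to the Penalized Knapsack Problem *)

(* Profits [2 a_j] against the common penalty [2 T - 1] make every nonempty
   packing of weight [s <= T] worth [2 s - 2 T + 1], which is [1] if [s = T] and
   negative otherwise. *)
Definition subset_sum_pkp (I : Type) (items : seq I) (wt : I -> nat) (T : nat) : pkp :=
  @PKP (size items)
    (fun j => 2 * wt (tnth (in_tuple items) j))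
    (fun j => wt (tnth (in_tuple items) j))
    (fun=> (2 * T).-1) T.

Section Gap.
Variables (I : eqType) (items : seq I) (wt : I -> nat) (T : nat).
Hypothesis T0 : 0 < T.

Let K := subset_sum_pkp items wt T.

Lemma subset_sum_code : pkp_code K = nat_code T ++
  flatten [seq nat_code (2 * wt p) ++ nat_code (wt p) ++ nat_code (2 * T).-1 | p <- items].
Proof.
rewrite /pkp_code; congr (_ ++ flatten _).
set f := (F in _ = map F _).
transitivity (map f [seq tnth (in_tuple items) j | j <- enum 'I_(size items)]).
  by rewrite -map_comp.
by rewrite map_tnth_enum.
Qed.

Definition load (x : solution K) := \sum_(j | x j) weight j.

Lemma objective_pos (x : solution K) : (exists j, x j) ->
  objective x = ((2 * load x)%:Z - (2 * T).-1%:Z)%R.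
Proof.
move=> [j xj]; rewrite /objective /load big_distrr /=; congr (_ - Posz _)%R.
apply/eqP; rewrite eqn_leq; apply/andP; split; first exact/bigmax_leqP.
exact: (leq_bigmax_cond (F := fun=> (2 * T).-1) j xj).
Qed.

Lemma objective_zero (x : solution K) : ~ (exists j, x j) -> objective x = 0%R.
Proof.
move=> nx; have x0 j : x j = false by apply/negP => xj; apply: nx; exists j.
by rewrite /objective !big_pred0.
Qed.

Lemma mem_solution_code (x : solution K) : true \in solution_code x <-> exists j, x j.
Proof.
split=> [/mapP[j _ xj]|[j xj]]; first by exists j.
by apply/mapP; exists j; rewrite ?mem_enum // xj.
Qed.

Lemma optimum_ge0 (J : pkp) : (0 <= optimum J)%R.
Proof.
have := @optimum_ge J [ffun=> false]; rewrite /feasible /objective !big_pred0 => [|j|j|j]; last 3 first.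
- by rewrite ffunE.
- by rewrite ffunE.
- by rewrite ffunE.
by apply.
Qed.

Import GRing.Theory Num.Theory Order.TTheory.

(** A positive optimum divided by [r] stays positive, which rules out the empty packing. Conversely,
    a nonempty packing of nonnegative value has [2 * load x >= 2 * T - 1], so by parity it weighs at
    least [T], and by feasibility exactly [T]. *)
Lemma approximation_gap (R : realType) (r : R) (y : seq bool) : (1 <= r)%R ->
  is_approximation r K y -> (true \in y <-> exists x : solution K, load x = T).
Proof.
move=> r1 [x [-> fx le]]; rewrite mem_solution_code.
have r0 : (0 < r)%R by apply: lt_le_trans r1.
split=> [ex|[x' e]].
- exists x; have : (0 <= objective x)%R.
    by rewrite -(ler0z R) (le_trans _ le) // divr_ge0 ?ler0z ?optimum_ge0 // ltW.
  rewrite (objective_pos ex); move: fx; rewrite /feasible -/(load x) /=; lia.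
- have ex' : exists j, x' j.
    apply: contrapT => /forallNP nx; move: T0; rewrite -e /load big_pred0 // => j.
    by apply/negP/nx.
  have fx' : feasible x' by rewrite /feasible -/(load x') e.
  have := optimum_ge fx'; rewrite (objective_pos ex') e => o1.
  apply: contrapT => nx; move: le; rewrite (objective_zero nx) leNgt divr_gt0 //.
  by rewrite ltr0z; lia.
Qed.

(** Distinctness lets a choice of positions be read as a predicate on the items themselves. *)
Lemma subset_sumP : uniq items ->
  (exists x : solution K, load x = T) <->
  exists y : pred I, \sum_(p <- items | y p) wt p = T.
Proof.
move=> /(tuple_uniqP (in_tuple items)) inj; split=> [[x <-]|[y <-]].
- exists (fun p => [exists j : 'I_(size items), (tnth (in_tuple items) j == p) && x j]).
  rewrite big_tnth /load; apply: eq_bigl => j.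
  apply/existsP/idP => [[i /andP[/eqP/inj-> //]]|xj].
  by exists j; rewrite eqxx.
- exists [ffun j => y (tnth (in_tuple items) j)].
  by rewrite [RHS]big_tnth; apply: eq_bigl => j; rewrite ffunE.
Qed.

End Gap.

(** * From tilings to subset sum *)

Section TilingSum.
Variables (tile H V : finType) (ok : pred tile).
Variables (lft rgt : tile -> option H) (bot top : tile -> V) (fin : V).

(* A tiling of a strip of [N] cells wound in rows of width [W]: cell [m] is to
   the left of cell [m + 1] and below cell [m + W].  The edge colour [None] is
   imposed at both ends of the strip. *)
Definition tiling (W N : nat) (inp : nat -> V) (f : nat -> tile) : Prop :=
  [/\ forall m, m < N -> ok (f m),
      forall m, m < N -> bot (f m) = if m < W then inp m else top (f (m - W)),
      forall m, m < N -> N <= m + W -> top (f m) = fin,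
      forall m, m < N -> lft (f m) = if m is m'.+1 then rgt (f m') else None
    & rgt (f N.-1) = None].

(** [None] has code 0, which is also what a missing neighbour contributes; this is how both ends of
    the strip are forced to be [None]. *)
Definition hcode (h : option H) : nat := if h is Some h then (enum_rank h).+1 else 0.
(** Codes start at 1, so the topmost block of every weight and of the target is nonzero and their
    highest bits are known. *)
Definition vcode (v : V) : nat := (enum_rank v).+1.

Definition tcard : nat := #|tile|.
Definition hcard : nat := #|H|.
Definition vcard : nat := #|V|.
(** A digit of a selection adds up at most two terms per tile, each bounded by [hcard], [vcard] or
    1. As [n < 2 ^ n], this many bits prevent carries. The width depends on the tiles only, so
    blocks are constant words for the printing program. *)
Definition dwidth : nat := 2 * tcard * (hcard + vcard + 1) + hcard + vcard + 2.
Definition dbase : nat := 2 ^ dwidth.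
Definition bwidth : nat := 3 * dwidth.
Definition bbase : nat := 2 ^ bwidth.

Definition digits3 (a b c : nat) : nat := a + dbase * (b + dbase * c).

(* The weight of a tile in cell [m] is spread over the three blocks [m], [m + 1]
   and [m + W].  The complemented code of an edge colour on one side meets its
   code on the other side. *)
Definition own_block t := digits3 1 (hcard - hcode (lft t)) (vcard - vcode (bot t)).
Definition right_block t := digits3 0 (hcode (rgt t)) 0.
Definition top_block t := digits3 0 0 (vcode (top t)).

(** In the first row no tile lies below, so the target digit is itself the complement of the imposed
    colour; from block [N] on only top colours arrive, and they must add up to the code of [fin]. *)
Definition input_block (v : V) := digits3 1 hcard (vcard - vcode v).
Definition inner_block := digits3 1 hcard vcard.
Definition final_block := digits3 0 0 (vcode fin).

Variables (W N : nat) (inp : nat -> V).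
Hypotheses (W0 : 0 < W) (leWN : W <= N).

Definition cell_weight (p : nat * tile) : nat :=
  bbase ^ p.1 * (own_block p.2 + bbase * right_block p.2 + bbase ^ W * top_block p.2).

Definition target_block (k : nat) : nat :=
  if k < W then input_block (inp k) else if k < N then inner_block else final_block.

Definition target : nat := \sum_(k < N + W) bbase ^ k * target_block k.

Definition cells : seq (nat * tile) := [seq (m, t) | m <- iota 0 N, t <- enum ok].

Lemma uniq_cells : uniq cells.
Proof.
apply: allpairs_uniq; rewrite ?iota_uniq ?enum_uniq //.
by move=> [a b] [c d] _ _ [-> ->].
Qed.

Lemma hcode_inj : injective hcode.
Proof. by move=> [h|] [h'|] // [/val_inj/enum_rank_inj->]. Qed.

Lemma vcode_inj : injective vcode.
Proof. by move=> v v' [/val_inj/enum_rank_inj]. Qed.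

Lemma hcode_le h : hcode h <= hcard.
Proof. by case: h => //= h; apply: ltn_ord. Qed.

Lemma vcode_le v : vcode v <= vcard.
Proof. exact: ltn_ord. Qed.

Lemma leq_sum_card (P : pred tile) (g : tile -> nat) c :
  (forall t, g t <= c) -> \sum_(t | P t) g t <= tcard * c.
Proof.
move=> le; apply: (@leq_trans (\sum_(t : tile) c)); last by rewrite sum_nat_const.
rewrite big_mkcond; apply: leq_sum => t _; by case: ifP.
Qed.

Lemma dbase_gt : 2 * tcard * (hcard + vcard + 1) + hcard + vcard + 2 < dbase.
Proof. exact: ltn_expl. Qed.

Lemma digits3_lt a b c : a < dbase -> b < dbase -> c < dbase -> digits3 a b c < bbase.
Proof.
rewrite /digits3 /bbase /bwidth (mulnC 3) expnM -/dbase !expnS expn0 muln1.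
have step d x y n : x < d -> y < n -> x + d * y < d * n.
  move=> xd yn; apply: (@leq_trans (d * y.+1)); last by rewrite leq_mul2l yn orbT.
  by rewrite mulnS ltn_add2r.
by move=> la lb lc; apply: (step _ _ _ _ la (step _ _ _ _ lb lc)).
Qed.

Lemma digits3_inj a b c a' b' c' :
  a < dbase -> b < dbase -> a' < dbase -> b' < dbase ->
  digits3 a b c = digits3 a' b' c' -> [/\ a = a', b = b' & c = c'].
Proof. by move=> la lb la' lb' /(digit_eq la la')[-> /(digit_eq lb lb')[-> ->]]. Qed.

Definition shifted (s : nat) (g : nat -> nat) (k : nat) : nat :=
  if (s <= k) && (k - s < N) then g (k - s) else 0.

Lemma sum_shifted b s (g : nat -> nat) : s <= W ->
  \sum_(m < N) b ^ (m + s) * g m = \sum_(k < N + W) b ^ k * shifted s g k.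
Proof.
move=> sW; rewrite -(big_mkord xpredT (fun k => b ^ k * shifted s g k)).
rewrite (@big_cat_nat _ _ _ s) //=; last by lia.
rewrite [X in _ = X + _]big_nat_cond [X in _ = X + _]big1 ?add0n => [|k]; last first.
  by move=> /andP[/andP[_ ks] _]; rewrite /shifted leqNgt ks muln0.
rewrite (@big_cat_nat _ _ _ (N + s)) //=; [|lia|lia].
rewrite [X in _ = _ + X]big_nat_cond [X in _ = _ + X]big1 ?addn0 => [|k]; last first.
  move=> /andP[/andP[ks _] _]; rewrite /shifted (_ : (k - s < N) = false) ?andbF ?muln0 //.
  by apply/negbTE; lia.
rewrite -{2}[s]add0n big_addn addnK big_mkord; apply: eq_bigr => m _.
by rewrite /shifted leq_addl addnK ltn_ord.
Qed.

(** * The digits of an arbitrary selection *)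

Section Selection.
Variable y : nat -> pred tile.

Let chosen k : pred tile := fun t => ok t && y k t.

Definition col (g : tile -> nat) (k : nat) : nat := \sum_(t | chosen k t) g t.

Definition count_sum := shifted 0 (col (fun=> 1)).
Definition left_sum k := shifted 0 (col (fun t => hcard - hcode (lft t))) k +
  shifted 1 (col (fun t => hcode (rgt t))) k.
Definition bottom_sum k := shifted 0 (col (fun t => vcard - vcode (bot t))) k +
  shifted W (col (fun t => vcode (top t))) k.

Lemma shifted_linear s g1 g2 g3 k : shifted s (fun k => digits3 (g1 k) (g2 k) (g3 k)) k =
  digits3 (shifted s g1 k) (shifted s g2 k) (shifted s g3 k).
Proof. by rewrite /shifted /digits3; case: ifP; rewrite // !muln0. Qed.

Lemma col_linear g1 g2 g3 k : col (fun t => digits3 (g1 t) (g2 t) (g3 t)) k =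
  digits3 (col g1 k) (col g2 k) (col g3 k).
Proof. by rewrite /col /digits3 !big_split /= -!big_distrr /= big_split -big_distrr. Qed.

Lemma col0 k : col (fun=> 0) k = 0. Proof. by rewrite /col big1. Qed.

(** Regroups the sum by blocks: block [k] collects the own blocks of cell [k], the right blocks of
    cell [k - 1] and the top blocks of cell [k - W]. *)
Lemma selection_sum : \sum_(p <- cells | y p.1 p.2) cell_weight p =
  \sum_(k < N + W) bbase ^ k * digits3 (count_sum k) (left_sum k) (bottom_sum k).
Proof.
transitivity (\sum_(m < N) (bbase ^ (m + 0) * col own_block m +
    bbase ^ (m + 1) * col right_block m + bbase ^ (m + W) * col top_block m)).
  rewrite big_mkcond /cells big_allpairs_dep -(big_mkord xpredT (fun m =>
    bbase ^ (m + 0) * col own_block m + bbase ^ (m + 1) * col right_block m +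
    bbase ^ (m + W) * col top_block m)) /index_iota subn0; apply: eq_bigr => m _.
  rewrite big_enum /= -big_mkcondr /= /col !big_distrr -!big_split /=.
  by apply: eq_bigr => t _; rewrite /cell_weight /= addn0 expnD expnD expn1; lia.
rewrite !big_split /= !sum_shifted // -!big_split /=; apply: eq_bigr => k _.
rewrite -!mulnDr; congr (_ * _).
have e s g1 g2 g3 : shifted s (col (fun t => digits3 (g1 t) (g2 t) (g3 t))) k =
    digits3 (shifted s (col g1) k) (shifted s (col g2) k) (shifted s (col g3) k).
  by rewrite -shifted_linear /shifted col_linear.
have z s : shifted s (col (fun=> 0)) k = 0 by rewrite /shifted col0; case: ifP.
rewrite /own_block /right_block /top_block !e !z /count_sum /left_sum /bottom_sum /digits3.
lia.
Qed.

Lemma shifted_col_le s g c k : (forall t, g t <= c) -> shifted s (col g) k <= tcard * c.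
Proof. by move=> le; rewrite /shifted; case: ifP => // _; apply: leq_sum_card. Qed.

Lemma count_sum_lt k : count_sum k < dbase.
Proof.
have := @shifted_col_le 0 (fun=> 1) 1 k (fun=> isT).
by rewrite -/(count_sum k) => le; apply: leq_ltn_trans le _; have := dbase_gt; nia.
Qed.

Lemma left_sum_lt k : left_sum k < dbase.
Proof.
have le1 := @shifted_col_le 0 _ _ k (fun t => leq_subr (hcode (lft t)) hcard).
have le2 := @shifted_col_le 1 _ _ k (fun t => hcode_le (rgt t)).
by apply: leq_ltn_trans (leq_add le1 le2) _; have := dbase_gt; nia.
Qed.

Lemma bottom_sum_lt k : bottom_sum k < dbase.
Proof.
have le1 := @shifted_col_le 0 _ _ k (fun t => leq_subr (vcode (bot t)) vcard).
have le2 := @shifted_col_le W _ _ k (fun t => vcode_le (top t)).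
by apply: leq_ltn_trans (leq_add le1 le2) _; have := dbase_gt; nia.
Qed.

Definition target_count k := (k < N : nat).
Definition target_left k := if k < N then hcard else 0.
Definition target_bottom k :=
  if k < W then vcard - vcode (inp k) else if k < N then vcard else vcode fin.

Lemma target_blockE k : target_block k = digits3 (target_count k) (target_left k) (target_bottom k).
Proof.
rewrite /target_block /target_count /target_left /target_bottom.
case: (ltnP k W) => kW; first by rewrite (leq_trans kW leWN).
by case: (ltnP k N).
Qed.

Lemma target_lt k :
  [/\ target_count k < dbase, target_left k < dbase & target_bottom k < dbase].
Proof.
have := vcode_le fin; have := dbase_gt; rewrite /target_count /target_left /target_bottom.
by move=> *; split; repeat case: ifP => _; lia.
Qed.

(** Both sides are expansions in base [bbase] with digits in range, and each of these consists of
    three digits in base [dbase], so one equation splits into three per block. *)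
Lemma selection_sumP : \sum_(p <- cells | y p.1 p.2) cell_weight p = target <->
  forall k, k < N + W -> [/\ count_sum k = target_count k, left_sum k = target_left k &
                             bottom_sum k = target_bottom k].
Proof.
rewrite selection_sum /target; split=> [e k ltk|h].
- have [t1 t2 t3] := target_lt k.
  suff : digits3 (count_sum k) (left_sum k) (bottom_sum k) = target_block k.
    rewrite target_blockE => /digits3_inj; apply=> //; [exact: count_sum_lt|exact: left_sum_lt].
  apply: (@digits_eq bbase (N + W)
    (fun k => digits3 (count_sum k) (left_sum k) (bottom_sum k)) target_block) => // j _.
  + by apply: digits3_lt; rewrite ?count_sum_lt ?left_sum_lt ?bottom_sum_lt.
  + by rewrite target_blockE; have [? ? ?] := target_lt j; apply: digits3_lt.
- apply: eq_bigr => k _; rewrite target_blockE.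
  by have [-> -> ->] := h k (ltn_ord k).
Qed.

End Selection.

(** The count digits turn the selection into a function from cells to tiles. Every other digit then
    involves at most two tiles, and injectivity of the codes gives equality of colours. *)
Lemma tiling_sumP :
  (exists f, tiling W N inp f) <->
  exists y : pred (nat * tile), \sum_(p <- cells | y p) cell_weight p = target.
Proof.
have N0 : 0 < N by apply: leq_trans leWN.
have colE y f g k : (forall t, (ok t && y k t) = (t == f k)) -> col y g k = g (f k).
  by move=> e; rewrite /col (eq_bigl _ _ e) big_pred1_eq.
split=> [[f [okf botf topf lftf rgtf]]|[y]].
- exists (fun p => p.2 == f p.1); apply/(selection_sumP (fun k t => t == f k)) => k ltk.
  have e g j : j < N -> col (fun k t => t == f k) g j = g (f j).
    move=> ltj; apply: colE => t; case: eqP => [->|_]; first by rewrite okf.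
    by rewrite andbF.
  rewrite /count_sum /left_sum /bottom_sum /target_count /target_left /target_bottom /shifted.
  rewrite leq0n subn0 /=; case: (ltnP k N) => kN; last first.
    have kW : W <= k by apply: leq_trans kN.
    have -> : (k < W) = false by apply/negbTE; rewrite -leqNgt.
    have ltkW : k - W < N by lia.
    rewrite kW ltkW /= (e _ _ ltkW) topf // ?subnK //; split=> //.
    (* Beyond the strip only block [N] receives a right colour, that of the last cell. *)
    case: ifP => // /andP[k0 kN1]; rewrite e //.
    by have -> : k - 1 = N.-1 by [lia]; rewrite rgtf.
  rewrite !(e _ _ kN) lftf // botf //. split=> //.
  + case: k kN {ltk} => [|k] kN; first by rewrite /= subn0 addn0.
    by rewrite subn1 /= (ltnW kN) e ?(ltnW kN) // subnK // hcode_le.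
  + case: (ltnP k W) => kW /=; first by rewrite addn0.
    have lt : k - W < N by apply: leq_ltn_trans (leq_subr _ _) kN.
    by rewrite lt e // subnK //; rewrite vcode_le.
- rewrite (eq_bigl (fun p => y (p.1, p.2))) => [|[] //].
  move=> /(selection_sumP (fun k t => y (k, t))) h.
  set y' := fun k t => y (k, t) in h.
  have count1 k : k < N -> exists t0, forall t, (ok t && y' k t) = (t == t0).
    move=> kN; have [+ _ _] := h k (ltn_addr _ kN).
    rewrite /count_sum /target_count /shifted leq0n subn0 kN /= /col sum1_card.
    by move=> /mem_card1[t0 e]; exists t0 => t; have := e t; rewrite !inE.
  (* [t0] only serves as the default value of the choice. *)
  have [t0 _] := count1 0 N0.
  pose f k := odflt t0 [pick t | ok t && y' k t].
  have fP k : k < N -> forall t, (ok t && y' k t) = (t == f k).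
    move=> /count1[t1 e]; rewrite /f; case: pickP => [t2|/(_ t1)] /=.
      by rewrite e => /eqP->.
    by rewrite e eqxx.
  have e g k : k < N -> col y' g k = g (f k) by move=> /fP; apply: colE.
  exists f; split=> [k kN|k kN|k kN NkW|k kN|].
  + by have := fP k kN (f k); rewrite eqxx => /andP[].
  + have [_ _] := h k (ltn_addr _ kN); rewrite /bottom_sum /target_bottom /shifted leq0n subn0 kN /= e //.
    have := vcode_le (bot (f k)); case: (ltnP k W) => kW /=.
      by have := vcode_le (inp k) => *; apply: vcode_inj; lia.
    have lt : k - W < N by apply: leq_ltn_trans (leq_subr _ _) kN.
    rewrite lt e //; have := vcode_le (top (f (k - W))) => *; apply: vcode_inj; lia.
  + have ltk : k + W < N + W by rewrite ltn_add2r.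
    have [_ _] := h _ ltk; rewrite /bottom_sum /target_bottom /shifted.
    rewrite leq_addl addnK kN /= (e _ _ kN) subn0.
    have -> : (k + W < N) = false by apply/negbTE; rewrite -leqNgt.
    have -> : (k + W < W) = false by apply/negbTE; rewrite -leqNgt leq_addl.
    by rewrite add0n => /vcode_inj.
  + have [_ + _] := h k (ltn_addr _ kN); rewrite /left_sum /target_left /shifted leq0n subn0 kN /= e //.
    have := hcode_le (lft (f k)); case: k kN => [|k] kN /=.
      by rewrite addn0 => *; apply: hcode_inj; rewrite /=; lia.
    by rewrite subn1 /= (ltnW kN) e ?(ltnW kN) //; have := hcode_le (rgt (f k)) => *; apply: hcode_inj; lia.
  + have ltN : N < N + W by rewrite -[X in X < _]addn0 ltn_add2l.
    have [_ + _] := h _ ltN; rewrite /left_sum /target_left /shifted subn0 ltnn leq0n /=.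
    by rewrite subn1 prednK // leqnn N0 e ?prednK //= => e'; apply: hcode_inj.
Qed.

(** * Explicit binary forms of weights, target and penalty *)

Lemma bits_value_blocks w n (g : nat -> nat) : (forall k, g k < 2 ^ w) ->
  bits_value (flatten [seq bits w (g k) | k <- iota 0 n]) = \sum_(k < n) (2 ^ w) ^ k * g k /\
  size (flatten [seq bits w (g k) | k <- iota 0 n]) = w * n.
Proof.
move=> lt; elim: n => [|n [IHv IHs]]; first by rewrite big_ord0 muln0.
have -> : iota 0 n.+1 = rcons (iota 0 n) n by rewrite -addn1 iotaD cats1.
rewrite map_rcons flatten_rcons bits_value_cat size_cat IHv IHs size_bits.
by rewrite bits_value_bits // big_ord_recr /= expnM mulnS (addnC w).
Qed.

Lemma own_block_lt t : own_block t < bbase.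
Proof. by have := dbase_gt => *; apply: digits3_lt; lia. Qed.

Lemma right_block_lt t : right_block t < bbase.
Proof. by have := dbase_gt; have := hcode_le (rgt t) => *; apply: digits3_lt; lia. Qed.

Lemma target_block_lt k : target_block k < bbase.
Proof. by rewrite target_blockE; have [? ? ?] := target_lt k; apply: digits3_lt. Qed.

Lemma dbase0 : 0 < dbase. Proof. by rewrite expn_gt0. Qed.

Lemma top_block_gt0 t : 0 < top_block t.
Proof. by rewrite /top_block /digits3 !add0n !muln_gt0 dbase0. Qed.

Lemma final_block_gt0 : 0 < final_block.
Proof. by rewrite /final_block /digits3 !add0n !muln_gt0 dbase0. Qed.

Definition weight_word m t : seq bool :=
  nseq (bwidth * m) false ++ (bits bwidth (own_block t) ++ bits bwidth (right_block t)) ++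
  nseq (bwidth * (W - 2)) false ++ binary (top_block t).

Definition target_word : seq bool :=
  flatten [seq bits bwidth (target_block k) | k <- iota 0 (N + W).-1] ++ binary final_block.

Hypothesis W2 : 2 <= W.

Lemma last_weight_word b m t : last b (weight_word m t).
Proof. by rewrite /weight_word !last_cat last_binary // top_block_gt0. Qed.

Lemma weight_wordE m t : bits_value (weight_word m t) = cell_weight (m, t).
Proof.
rewrite /weight_word !bits_value_cat !bits_value_zeros !size_cat !size_bits !size_nseq.
rewrite binaryK !bits_value_bits ?own_block_lt ?right_block_lt // !add0n /cell_weight /=.
rewrite !(expnM 2 bwidth) (expnD 2 bwidth) -/bbase -(subnK W2) addnK; move: (W - 2) => j.
rewrite (expnD bbase) -mulnn; move: (bbase ^ j) (bbase ^ m) bbase => a b c; ring.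
Qed.

Lemma binary_weight m t : binary (cell_weight (m, t)) = weight_word m t.
Proof. by rewrite -weight_wordE binary_bits_value // last_weight_word. Qed.

Lemma binary_profit m t : binary (2 * cell_weight (m, t)) = false :: weight_word m t.
Proof.
have -> : 2 * cell_weight (m, t) = bits_value (false :: weight_word m t).
  by rewrite /= weight_wordE mul2n.
by apply: binary_bits_value; apply: last_weight_word.
Qed.

Lemma target_wordE : bits_value target_word = target.
Proof.
have [e1 e2] := bits_value_blocks (N + W).-1 target_block_lt.
rewrite /target_word bits_value_cat e1 e2 binaryK /target.
have NW : 0 < N + W by rewrite addn_gt0 W0 orbT.
rewrite -[in RHS](prednK NW) big_ord_recr /= expnM -/bbase; congr (_ + _ * _).
rewrite /target_block; case: ltnP => [|_]; first by lia.
by case: ltnP => //; lia.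
Qed.

Lemma last_target_word b : last b target_word.
Proof. by rewrite /target_word last_cat last_binary // final_block_gt0. Qed.

Lemma binary_target : binary target = target_word.
Proof. by rewrite -target_wordE binary_bits_value // last_target_word. Qed.

(** The count digit of block 0 is 1 and the base is even, so the target is odd. *)
Lemma target_word_split : exists s, target_word = true :: s ++ binary final_block.
Proof.
have dw : bwidth = bwidth.-1.+1 by rewrite prednK // /bwidth /dwidth; lia.
have [n e] : exists n, (N + W).-1 = n.+1 by exists (N + W).-2; lia.
rewrite /target_word e /= {1}dw bits_recl /= -catA; eexists; rewrite catA; congr cons.
rewrite target_blockE /digits3 /target_count (leq_trans W0 leWN) oddD oddM.
by rewrite /dbase oddX /dwidth /= addnS.
Qed.

Lemma target_word_cons : target_word = true :: behead target_word.
Proof. by have [s ->] := target_word_split. Qed.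

Lemma target_gt0 : 0 < target.
Proof. by rewrite -target_wordE target_word_cons. Qed.

(** If the target is [1 + 2 v], then the penalty is [1 + 4 v]: its word is that of the target with
    one [false] inserted after the first bit, so no subtraction is ever carried out. *)
Lemma binary_penalty : binary (2 * target).-1 = true :: false :: behead target_word.
Proof.
have -> : (2 * target).-1 = bits_value (true :: false :: behead target_word).
  by rewrite -target_wordE target_word_cons /=; lia.
apply: binary_bits_value; have [s ->] := target_word_split.
by rewrite /= last_cat last_binary // final_block_gt0.
Qed.

End TilingSum.

(** * From computations to tilings *)

Definition move_code (m : move) : option bool :=
  match m with MoveLeft => Some false | Stay => None | MoveRight => Some true end.

Definition move_decode (o : option bool) : move :=
  match o with Some false => MoveLeft | None => Stay | Some true => MoveRight end.

Lemma move_codeK : cancel move_code move_decode. Proof. by case. Qed.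

HB.instance Definition _ := Finite.copy move (can_type move_codeK).

(** * Winding a rectangle into a strip *)

Section TwoDim.
Variables (tile H V : finType) (ok : pred tile).
Variables (lft rgt : tile -> option H) (bot top : tile -> V) (fin : V).
Variables (W h : nat) (inp : nat -> V).
Hypotheses (W0 : 0 < W) (h0 : 0 < h).

Definition rect_tiling (g : nat -> nat -> tile) : Prop :=
  [/\ forall i j, i < h -> j < W -> ok (g i j),
      forall j, j < W -> bot (g 0 j) = inp j,
      forall i j, i.+1 < h -> j < W -> bot (g i.+1 j) = top (g i j),
      forall j, j < W -> top (g h.-1 j) = fin
    & forall i, i < h -> [/\ lft (g i 0) = None, rgt (g i W.-1) = None
        & forall j, j.+1 < W -> lft (g i j.+1) = rgt (g i j)]].

(* [flag] marks the colours of the first column: it is what makes a tiling of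
   the wound strip break into rows. *)
Variable flag : V -> bool.
Hypotheses (flag_lft : forall t, flag (bot t) = (lft t == None))
  (flag_top : forall t, top t <> fin -> flag (top t) = flag (bot t))
  (bot_fin : forall t, bot t <> fin)
  (flag_inp : forall j, j < W -> flag (inp j) = (j == 0)).

Notation tiling := (tiling ok lft rgt bot top fin W (h * W) inp).

(** The flag passes upwards by induction on the rows; [flag_top] applies because a colour handed
    upwards is a bottom colour and so differs from [fin]. Hence the left colour is [None] in the
    first column, and so is the right colour it meets at the end of the row before. *)
Lemma rect_tilingP : (exists f, tiling f) <-> (exists g, rect_tiling g).
Proof.
have cell_lt i j : i < h -> j < W -> i * W + j < h * W.
  by move=> ih jW; apply: (@leq_trans (i.+1 * W)); rewrite ?leq_mul2r ?ih ?orbT // mulSnr ltn_add2l.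
split=> [[f [okf botf topf lftf rgtf]]|[g [okg bot0 botS topg lr]]].
- have flagE i j : i < h -> j < W -> flag (bot (f (i * W + j))) = (j == 0).
    elim: i j => [|i IHi] j ih jW.
      by rewrite mul0n botf ?jW ?flag_inp // (cell_lt 0 j).
    have := botf _ (cell_lt _ _ ih jW).
    rewrite ltnNge mulSn -addnA leq_addr /= addKn => e; rewrite e flag_top -?e //.
    by apply: IHi => //; apply: ltnW.
  exists (fun i j => f (i * W + j)); split=> [i j ih jW|j jW|i j ih jW|j jW|i ih].
  + exact/okf/cell_lt.
  + by rewrite mul0n botf ?jW // (cell_lt 0 j).
  + rewrite botf; last exact: cell_lt.
    by rewrite ltnNge mulSn -addnA leq_addr /= addKn.
  + apply: topf; first by apply: cell_lt; rewrite ?prednK.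
    by rewrite -{1}(prednK h0) mulSnr addnAC leq_addr.
  + have l0 k : k < h -> lft (f (k * W + 0)) = None.
      by move=> kh; apply/eqP; rewrite -flag_lft flagE.
    split; first exact: l0.
      have [ih1|] := ltnP i.+1 h.
        have e : i.+1 * W + 0 = (i * W + W.-1).+1.
          by rewrite addn0 mulSnr -{2}(prednK W0) addnS.
        have := l0 _ ih1; have := cell_lt _ _ ih1 W0; rewrite e => lt.
        by rewrite lftf.
      move=> hi; have -> : i * W + W.-1 = (h * W).-1; last exact: rgtf.
      have -> : h = i.+1 by lia.
      by rewrite mulSnr -{4}(prednK W0) addnS.
    move=> j jW; rewrite lftf; last exact: cell_lt.
    by rewrite addnS.
- exists (fun m => g (m %/ W) (m %% W)).
  have lt_row m : m < h * W -> m %/ W < h by rewrite ltn_divLR.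
  have lt_col m : m %% W < W by rewrite ltn_mod.
  split=> [m mN|m mN|m mN Nm|m mN|].
  + by apply: okg; rewrite ?lt_row.
  + case: ltnP => [mW|Wm]; first by rewrite divn_small // modn_small // bot0.
    have e : m %/ W = ((m - W) %/ W).+1 by rewrite -{1}(subnK Wm) divnDr ?divnn ?W0 ?addn1.
    rewrite e botS -?e ?lt_row //; congr (top (g _ _)).
    by rewrite -{1}(subnK Wm) modnDr.
  + have -> : m %/ W = h.-1; last exact: topg.
    apply/eqP; rewrite eqn_leq -ltnS prednK // lt_row //= leq_divRL //.
    by rewrite -subn1 mulnBl mul1n leq_subLR addnC.
  + case: m mN => [|m] mN.
      by rewrite div0n mod0n; have [] := lr 0 h0.
    have := ltn_mod m W; rewrite W0; case: (ltnP (m %% W).+1 W) => [mW _|Wm mW].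
      have e1 : m.+1 %/ W = m %/ W.
        by rewrite {1}(divn_eq m W) -addnS divnMDl // (divn_small mW) addn0.
      have e2 : m.+1 %% W = (m %% W).+1.
        by rewrite {1}(divn_eq m W) -addnS modnMDl modn_small.
      rewrite e1 e2; have [_ _ ->] // := lr _ (lt_row _ (ltnW mN)).
    have e0 : (m %% W).+1 = W by lia.
    have e1 : m.+1 %% W = 0.
      by rewrite {1}(divn_eq m W) -addnS modnMDl e0 modnn.
    rewrite e1; have [-> _ _] := lr _ (lt_row _ mN).
    have [_ + _] := lr _ (lt_row _ (ltnW mN)).
    by have -> : m %% W = W.-1 by lia.
  + have N0 : 0 < h * W by rewrite muln_gt0 h0.
    have e : (h * W).-1 = h.-1 * W + W.-1.
      by rewrite -{1}(prednK h0) mulSnr -{2}(prednK W0) addnS.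
    rewrite e divnMDl // modnMDl !(divn_small, modn_small) ?prednK // addn0.
    by have [] := lr h.-1 _; rewrite ?prednK.
Qed.

End TwoDim.

(** * The tile set of a machine *)

Section Tableau.
Variable M : tm.

Let I := 'I_(tm_tapes M).+1.
Let A := prog_of M.
Let sym := cell (tm_symbol M).

(* Column [j] of a configuration holds, for each tape, the cells at distance [j]
   to the left and to the right of the head; column [0] also holds the state. *)
Let contents : finType := {ffun I -> sym * sym}.
Let moves : finType := {ffun I -> move}.

(** An edge in a step row carries the moves and the contents on both of its sides, so a tile knows
    its two neighbours. An edge in the load row carries the symbol entered in the column to its
    right. *)
Inductive hcolour := HLoad of option bool | HStep of moves & contents & contents | HFin.

Inductive vcolour := VStart | VIn of option bool | VGuess
  | VHead of tm_state M & contents | VBody of contents | VFin.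

(* The last argument describes the right neighbour: it is [None], or [false], in
   the last column. *)
Inductive cell_tile :=
  | LoadHead of option (option bool)
  | LoadBody of bool & option bool & option (option bool)
  | StepHead of tm_state M & contents & option contents
  | StepBody of moves & contents & contents & option contents
  | FinHead of tm_state M & contents & bool
  | FinBody of contents & bool.

Definition hcolour_code (c : hcolour) : option bool + (moves * contents * contents) + unit :=
  match c with
  | HLoad b => inl (inl b) | HStep m a b => inl (inr (m, a, b)) | HFin => inr tt
  end.

Definition hcolour_decode (c : option bool + (moves * contents * contents) + unit) : option hcolour :=
  match c with
  | inl (inl b) => Some (HLoad b) | inl (inr (m, a, b)) => Some (HStep m a b)
  | inr _ => Some HFin
  end.

Lemma hcolour_codeK : pcancel hcolour_code hcolour_decode. Proof. by case. Qed.

HB.instance Definition _ := Finite.copy hcolour (pcan_type hcolour_codeK).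

Definition vcolour_code (c : vcolour) :
    option (option bool) + (tm_state M * contents) + contents + bool :=
  match c with
  | VStart => inr true | VFin => inr false | VGuess => inl (inl (inl None))
  | VIn b => inl (inl (inl (Some b))) | VHead q a => inl (inl (inr (q, a)))
  | VBody a => inl (inr a)
  end.

Definition vcolour_decode
    (c : option (option bool) + (tm_state M * contents) + contents + bool) : option vcolour :=
  match c with
  | inr true => Some VStart | inr false => Some VFin | inl (inl (inl None)) => Some VGuess
  | inl (inl (inl (Some b))) => Some (VIn b) | inl (inl (inr (q, a))) => Some (VHead q a)
  | inl (inr a) => Some (VBody a)
  end.

Lemma vcolour_codeK : pcancel vcolour_code vcolour_decode. Proof. by case. Qed.

HB.instance Definition _ := Finite.copy vcolour (pcan_type vcolour_codeK).

Definition tile_code (t : cell_tile) :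
    option (option bool) + (bool * option bool * option (option bool)) +
    ((tm_state M * contents * option contents) +
     (moves * contents * contents * option contents)) +
    ((tm_state M * contents * bool) + (contents * bool)) :=
  match t with
  | LoadHead b => inl (inl (inl b)) | LoadBody g a b => inl (inl (inr (g, a, b)))
  | StepHead q c r => inl (inr (inl (q, c, r)))
  | StepBody m l c r => inl (inr (inr (m, l, c, r)))
  | FinHead q c b => inr (inl (q, c, b)) | FinBody c b => inr (inr (c, b))
  end.

Definition tile_decode
    (t : option (option bool) + (bool * option bool * option (option bool)) +
      ((tm_state M * contents * option contents) +
       (moves * contents * contents * option contents)) +
      ((tm_state M * contents * bool) + (contents * bool))) : option cell_tile :=
  match t with
  | inl (inl (inl b)) => Some (LoadHead b) | inl (inl (inr (g, a, b))) => Some (LoadBody g a b)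
  | inl (inr (inl (q, c, r))) => Some (StepHead q c r)
  | inl (inr (inr (m, l, c, r))) => Some (StepBody m l c r)
  | inr (inl (q, c, b)) => Some (FinHead q c b) | inr (inr (c, b)) => Some (FinBody c b)
  end.

Lemma tile_codeK : pcancel tile_code tile_decode. Proof. by case. Qed.

HB.instance Definition _ := Finite.copy cell_tile (pcan_type tile_codeK).

Definition no_contents : contents := [ffun=> (None, None)].

Definition load_contents (s : option bool) : contents :=
  [ffun i => (None, if i == ord0 then omap inl s else None)].

Definition write_contents (c : contents) (a : I -> sym * move) : contents :=
  [ffun i => ((c i).1, (a i).1)].

(** Past column 0 a row continues as its mirror image: moving the head left brings cell 0 of the
    left half under the head. So the virtual left neighbour of column 0 is column 0 with its halves
    exchanged. *)
Definition swap_contents (c : contents) : contents := [ffun i => ((c i).2, (c i).1)].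

Definition shift_contents (m : moves) (l c r : contents) : contents :=
  [ffun i => match m i with
             | MoveLeft => ((r i).1, (l i).2)
             | Stay => c i
             | MoveRight => ((l i).1, (r i).2)
             end].

(** A halted configuration repeats itself, as in [fstep], so a verifier that halts early still fills
    all rows. *)
Definition head_step (q : tm_state M) (c : contents) : tm_state M * moves * contents :=
  if tm_trans q [ffun i => (c i).2] is Some (q', a)
  then (q', [ffun i => (a i).2], write_contents c a) else (q, [ffun=> Stay], c).

Definition tile_lft (t : cell_tile) : option hcolour :=
  match t with
  | LoadBody _ a _ => Some (HLoad a)
  | StepBody m l c _ => Some (HStep m l c)
  | FinBody _ _ => Some HFin
  | _ => None
  end.

Definition tile_rgt (t : cell_tile) : option hcolour :=
  match t with
  | LoadHead b | LoadBody _ _ b => omap HLoad b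
  | StepHead q c r =>
      let: (_, m, w) := head_step q c in omap (HStep m w) r
  | StepBody m _ c r => omap (HStep m c) r
  | FinHead _ _ b | FinBody _ b => if b then Some HFin else None
  end.

Definition tile_bot (t : cell_tile) : vcolour :=
  match t with
  | LoadHead _ => VStart
  | LoadBody g a _ => if g then VGuess else VIn a
  | StepHead q c _ | FinHead q c _ => VHead q c
  | StepBody _ _ c _ | FinBody c _ => VBody c
  end.

Definition tile_top (t : cell_tile) : vcolour :=
  match t with
  | LoadHead b => VHead (tm_start M) (load_contents (odflt None b))
  | LoadBody _ _ b => VBody (load_contents (odflt None b))
  | StepHead q c r =>
      let: (q', m, w) := head_step q c in
      VHead q' (shift_contents m (swap_contents w) w (odflt no_contents r))
  | StepBody m l c r => VBody (shift_contents m l c (odflt no_contents r))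
  | FinHead _ _ _ | FinBody _ _ => VFin
  end.

(** After its first blank a load row stays blank, so the guessed symbols form a word. For acceptance
    it is enough to look at the cell under the output head, as a verifier outputs a single bit. *)
Definition tile_ok (t : cell_tile) : bool :=
  match t with
  | LoadBody _ a b => (a == None) ==> (odflt None b == None)
  | FinHead _ c _ => (c ord_max).2 == Some (inl true)
  | _ => true
  end.

Definition first_column (v : vcolour) : bool :=
  match v with VStart | VHead _ _ => true | _ => false end.

Lemma first_column_lft t : first_column (tile_bot t) = (tile_lft t == None).
Proof. by case: t => // -[]. Qed.

Lemma first_column_top t : tile_top t <> VFin -> first_column (tile_top t) = first_column (tile_bot t).
Proof. by case: t => //= [[]|q c r] //; case: head_step => [[]]. Qed.

Lemma tile_bot_fin t : tile_bot t <> VFin.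
Proof. by case: t => // -[]. Qed.

Definition column (tp : I -> ftape (tm_symbol M)) (j : nat) : contents :=
  [ffun i => ((tp i).1 j, (tp i).2 j)].

Definition wcolumn tp (w : contents) (j : nat) : contents :=
  if j is 0 then w else column tp j.

Lemma head_stepE q tp : let: (q', m, w) := head_step q (column tp 0) in
  exists tp', [/\ @fstep _ _ A (q, tp) = (q', tp'),
    column tp' 0 = shift_contents m (swap_contents w) w (column tp 1) &
    forall j, column tp' j.+1 =
      shift_contents m (wcolumn tp w j) (column tp j.+1) (column tp j.+2)].
Proof.
rewrite /head_step /fstep /fnext /=.
have -> : [ffun i => (column tp 0 i).2] = fscan tp by apply/ffunP => i; rewrite !ffunE.
case: tm_trans => [[q' a]|] /=.
- exists (fun i => fact (tp i) (a i)); split=> // [|j]; apply/ffunP => i; rewrite !ffunE.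
    by case: (tp i) => l r; case: (a i) => s [].
  case: j => [|j]; rewrite /wcolumn !ffunE; case: (tp i) => l r; case: (a i) => s [] //.
- exists tp; split=> // [|j]; by apply/ffunP => i; rewrite !ffunE.
Qed.

Section Run.
Variable z : seq bool.

Let C t := iter t (@fstep _ _ A) (tm_start M, finput (tm_symbol M) z).

Lemma column_input j :
  column (finput (tm_symbol M) z) j = load_contents (nth None [seq Some b | b <- z] j).
Proof.
apply/ffunP => i; rewrite !ffunE /finput; case: eqP => _ //=; congr pair.
by elim: z j => [|b s IHs] [|j] //=.
Qed.

(** A step shifts each tape by at most one column, so the nonblank part of a row grows by at most
    one column per step. This is why a polynomial width suffices. *)
Lemma column_far t j : size z + t < j -> column (C t).2 j = no_contents.
Proof.
elim: t j => [|t IHt] j le.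
  rewrite column_input nth_default ?size_map; last by rewrite addn0 in le; apply: ltnW.
  by apply/ffunP => i; rewrite !ffunE; case: ifP.
rewrite /C iterS -/(C t); case: (C t) IHt => q tp /= IHt.
have := head_stepE q tp; case: head_step => [[q' m] w] [tp' [-> _ e]] /=.
case: j le => [|[|j]] le; [by [] | by move: le; rewrite addnS | ].
have le1 : size z + t < j.+1 by rewrite -ltnS -addnS.
rewrite e /= !IHt ?ltnS ?leqW //.
by apply/ffunP => i; rewrite !ffunE; case: (m i).
Qed.

End Run.

(** * Tilings of the rectangle versus accepting runs *)

Section Input.
Variables (d : seq bool) (Q R T : nat).
Hypotheses (d0 : 0 < size d) (TR : T <= R).

Definition tableau_input (j : nat) : vcolour :=
  if j is j'.+1 then
    if j' < size d then VIn (Some (nth false d j'))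
    else if j' < size d + Q then VGuess else VIn None
  else VStart.

Definition tableau_width : nat := (size d + Q + R).+1.
(** A load row, [T] step rows and a final row. *)
Definition tableau_height : nat := T.+2.

Let W := tableau_width.
Let h := tableau_height.

Lemma first_column_input j : first_column (tableau_input j) = (j == 0).
Proof. by case: j => //= j; case: ifP => // _; case: ifP. Qed.

Notation rect_tiling := (rect_tiling tile_ok tile_lft tile_rgt tile_bot tile_top VFin W h tableau_input).

Let C u t := iter t (@fstep _ _ A) (tm_start M, finput (tm_symbol M) (d ++ u)).

Definition accepts_at u t := ((C u t).2 ord_max).2 0 = Some (inl true).

Definition right_of (T' : Type) (X : nat -> T') (j : nat) : option T' :=
  if j.+1 < W then Some (X j.+1) else None.

(** The last tile of a row has no right neighbour; its default stands for column [W], which is still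
    blank. *)
Lemma odflt_right_of (T' : Type) (x : T') X j : j < W -> X W = x -> odflt x (right_of X j) = X j.+1.
Proof.
rewrite /right_of => jW; case: ltnP => //= Wj <-.
by congr X; apply/eqP; rewrite eqn_leq jW Wj.
Qed.

Lemma tableau_complete u : size u <= Q -> accepts_at u T -> exists g, rect_tiling g.
Proof.
move=> uQ acc.
pose s := nth None [seq Some b | b <- d ++ u].
pose col t := column (C u t).2.
have colW t : t <= T -> col t W = no_contents.
  by move=> tT; apply: column_far; rewrite size_cat /W /tableau_width; lia.
have s_far k : size d + size u <= k -> s k = None.
  by move=> le; rewrite /s nth_default // size_map size_cat.
pose sr k := s k.-1.
have srW : sr W = None by apply: s_far; rewrite /= -addnA leq_add2l (leq_trans uQ) ?leq_addr.
(* Column 0 of the input is taken by the start mark, so symbol [j] enters in column [j + 1] although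
   it belongs at distance [j]. The load row corrects this: each tile puts the symbol of its right
   neighbour on top. *)
pose load j := if j is j'.+1 then LoadBody (size d <= j' < size d + Q) (s j') (right_of sr j)
               else LoadHead (right_of sr 0).
pose fins t j := if j is j'.+1 then FinBody (col t j) (j.+1 < W)
                 else FinHead (C u t).1 (col t 0) (1 < W).
pose stp t j := let: (_, m, w) := head_step (C u t).1 (col t 0) in
  if j is j'.+1 then StepBody m (wcolumn (C u t).2 w j') (col t j) (right_of (col t) j)
  else StepHead (C u t).1 (col t 0) (right_of (col t) 0).
pose row t j := if j is 0 then VHead (C u t).1 (col t 0) else VBody (col t j).
have bot_fins t j : tile_bot (fins t j) = row t j by case: j.
have bot_stp t j : tile_bot (stp t j) = row t j.
  by rewrite /stp; case: head_step => [[? ?] ?]; case: j.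
have top_load j : j < W -> tile_top (load j) = row 0 j.
  move=> jW; have e := odflt_right_of jW srW.
  by case: j jW e => [|j] jW e; rewrite /row /load /= e /col /= column_input.
have top_stp t j : t < T -> j < W -> tile_top (stp t j) = row t.+1 j.
  move=> tT jW; have e := odflt_right_of jW (colW t (ltnW tT)).
  rewrite /stp /row /col /C iterS -/(C u t); have := head_stepE (C u t).1 (C u t).2.
  case E: head_step => [[q m] w] [tp' [eC c0 cS]].
  rewrite -surjective_pairing in eC; rewrite eC /=.
  by case: j jW e => [|j] jW e; rewrite /= ?E e ?c0 ?cS.
exists (fun i j => if i is t.+1 then if t == T then fins t j else stp t j else load j).
split=> [[|t] j ih jW|j jW|[|t] j ih jW|j jW|i ih].
- case: j {jW} => //= j; apply/implyP => /eqP sj; apply/eqP.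
  rewrite /right_of; case: ifP => //= _; rewrite /sr /=.
  apply: s_far; rewrite leqW // -size_cat leqNgt; apply/negP => lt.
  by move: sj; rewrite /s (nth_map false).
- case: ifP => [/eqP->|_]; last by rewrite /stp; case: head_step => [[? ?] ?]; case: (j).
  by case: j {jW} => //=; rewrite ffunE /=; apply/eqP.
- case: j jW => //= j jW; case: (ltnP j (size d)) => /= jd.
    by rewrite /s (nth_map false) ?size_cat ?ltn_addr // nth_cat jd.
  case: ifP => // jQ; rewrite s_far //.
  by apply: leq_trans (_ : size d + Q <= j); rewrite ?leq_add2l // leqNgt jQ.
- by rewrite top_load //; case: ifP.
- have tT : t < T by [].
  rewrite (ltn_eqF tT) top_stp //; by case: ifP => _; rewrite ?bot_fins ?bot_stp.
- by rewrite /= eqxx; case: j {jW}.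
- have W1 : 1 < W by rewrite /W /tableau_width ltnS -addnA addn_gt0 d0.
  have [k eW] : exists k, W = k.+2 by exists W.-2; rewrite -subn2 -addn2 subnK.
  have lastW : k.+2 < W = false by rewrite eW ltnn.
  have -> : W.-1 = k.+1 by rewrite eW.
  case: i ih => [|t] ih.
    split=> [//||j jW]; first by rewrite /= /right_of lastW.
    by case: j jW => [|j] jW; rewrite /= /right_of jW.
  case: ifP => _.
    split=> [//||j jW]; first by rewrite /= lastW.
    by case: j jW => [|j] jW; rewrite /= jW.
  rewrite /stp; case E: head_step => [[q m] w]; split=> [//||j jW].
    by rewrite /= /right_of lastW.
  by case: j jW => [|j] jW; rewrite /= ?E /right_of jW.
Qed.

(** Extracts the certificate from the symbols guessed in the load row. *)
Lemma option_seq (n : nat) (s : nat -> option bool) :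
  (forall k, s k = None -> s k.+1 = None) -> (forall k, n <= k -> s k = None) ->
  exists2 u, size u <= n & forall k, s k = nth None [seq Some b | b <- u] k.
Proof.
elim: n s => [|n IHn] s mono far; first by exists [::] => // k; rewrite far // nth_nil.
case s0: (s 0) => [b|].
  have [u un uE] := IHn (fun k => s k.+1) (fun k => mono k.+1) (fun k => far k.+1).
  by exists (b :: u) => // -[|k] //=; rewrite -uE.
by exists [::] => // k; rewrite nth_nil; elim: k => // k /mono.
Qed.

(** The load row yields a certificate, and every later row is forced: its bottom colours determine
    the kinds of tiles, the head tile computes moves and written symbols, and the horizontal colours
    carry them along. *)
Lemma tableau_sound g : rect_tiling g -> exists2 u, size u <= Q & accepts_at u T.
Proof.
move=> [okg bot0 botS topg lr].
have h0 : 0 < h by [].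
have [lft0 _ lrS0] := lr 0 h0.
pose s j := if j.+1 < W then
              if tile_lft (g 0 j.+1) is Some (HLoad a) then a else None
            else None.
have load_body j : j.+1 < W -> exists gs b, g 0 j.+1 = LoadBody gs (s j) b.
  move=> jW; rewrite /s jW; have := bot0 _ jW.
  case: (g 0 j.+1) => [b|gs a b|q c r|m l c r|q c b|c b] /=; try by do 2?case: ifP => //.
  by exists gs, b.
have right_load j b : j < W -> tile_rgt (g 0 j) = omap HLoad b -> odflt None b = s j.
  move=> jW; case: (ltnP j.+1 W) => [jW1|Wj].
    rewrite -lrS0 //; have [gs [b' ->]] := load_body _ jW1 => /=.
    by case: b => //= b [].
  have -> : j = W.-1 by lia.
  have [_ -> _] := lr 0 h0; case: b => // _.
  by rewrite /s prednK ?ltnn.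
have top0 j : j < W -> tile_top (g 0 j) =
    if j is 0 then VHead (tm_start M) (load_contents (s 0)) else VBody (load_contents (s j)).
  case: j => [|j] jW.
    have := bot0 _ jW; have := @right_load 0; rewrite /=.
    case: (g 0 0) => [b|gs a b|q c r|m l c r|q c b|c b] //=; last by case: gs.
    by move=> /(_ b jW erefl) ->.
  have [gs [b e]] := load_body _ jW.
  by rewrite e /= (right_load _ _ jW) // e.
have s_mono k : s k = None -> s k.+1 = None.
  move=> sk; case: (ltnP k.+1 W) => kW; last by rewrite /s ltnNge leqW.
  have [gs [b e]] := load_body _ kW; have := okg 0 k.+1 h0 kW.
  have := right_load _ b kW; rewrite e /= sk eqxx /= => /(_ erefl) <-.
  by move=> /eqP.
have s_d k : k < size d -> s k = Some (nth false d k).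
  move=> kd; have kW : k.+1 < W by rewrite /W /tableau_width; lia.
  have [gs [b e]] := load_body _ kW; have := bot0 _ kW.
  by rewrite e /= kd; case: gs {e} => // -[].
have s_far k : size d + Q <= k -> s k = None.
  move=> kd; case: (ltnP k.+1 W) => kW; last by rewrite /s ltnNge kW.
  have [gs [b e]] := load_body _ kW; have := bot0 _ kW.
  rewrite e /= !ltnNge kd (leq_trans _ kd) ?leq_addr //=.
  by case: gs {e} => // -[].
have [k|k Qk|u uQ uE] := @option_seq Q (fun k => s (size d + k)).
- by rewrite addnS; apply: s_mono.
- by rewrite s_far // leq_add2l.
exists u => //.
have sE k : s k = nth None [seq Some b | b <- d ++ u] k.
  rewrite map_cat nth_cat size_map; case: ltnP => kd; first by rewrite s_d // (nth_map false).
  by rewrite -uE subnKC.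
pose col t := column (C u t).2.
have colW t : t <= T -> col t W = no_contents.
  by move=> tT; apply: column_far; rewrite size_cat /W /tableau_width; lia.
have rowE t : t <= T -> forall j, j < W -> tile_top (g t j) =
    if j is 0 then VHead (C u t).1 (col t 0) else VBody (col t j).
  elim: t => [|t IHt] tT j jW.
    by rewrite top0 // /col /=; case: j {jW} => [|j]; rewrite column_input sE.
  have th : t.+1 < h by rewrite ltnS ltnW // ltnS.
  have {}IHt k : k < W -> tile_bot (g t.+1 k) =
      if k is 0 then VHead (C u t).1 (col t 0) else VBody (col t k).
    by move=> kW; rewrite botS // IHt // ltnW.
  have [_ rgtW lrS] := lr _ th.
  have tW := colW t (ltnW tT).
  have right_step k m w r : k < W -> tile_rgt (g t.+1 k) = omap (HStep m w) r ->
      odflt no_contents r = col t k.+1 /\ (k.+1 < W -> exists r',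
        g t.+1 k.+1 = StepBody m w (col t k.+1) r').
    move=> kW; case: (ltnP k.+1 W) => [kW1|Wk].
      rewrite -lrS //; have := IHt _ kW1.
      case: (g t.+1 k.+1) => [b|[] a b|q c r'|m' l c r'|q c b|c b] //= [->]; case: r => //= r [-> -> ->].
      by split=> // _; exists r'.
    have -> : k = W.-1 by lia.
    by rewrite rgtW; case: r => // _; split=> //; rewrite /= -tW.
  have W0 : 0 < W by [].
  have [r g0] : exists r, g t.+1 0 = StepHead (C u t).1 (col t 0) r.
    have := IHt 0 W0; have := botS t.+1 0.
    case: (g t.+1 0) => [b|[] a b|q c r'|m' l c r'|q c b|c b] //= e [-> ->]; first by exists r'.
    (* A final tile here would present [VFin] to the row above, where no bottom colour equals it. *)
    by have := e _ W0 => /(_ tT)/tile_bot_fin.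
  have hs := head_stepE (C u t).1 (C u t).2.
  have eC : (C u t.+1) = @fstep _ _ A (C u t) by [].
  case E: head_step hs => [[q m] w] [tp' [+ c0 cS]].
  rewrite -surjective_pairing -eC => {}eC.
  have r0 : tile_rgt (g t.+1 0) = omap (HStep m w) r by rewrite g0 /= E.
  (* The moves chosen in column 0 spread from left to right along the row. *)
  have body k : k.+1 < W -> exists r', g t.+1 k.+1 = StepBody m (wcolumn (C u t).2 w k) (col t k.+1) r'.
    elim: k => [|k IHk] kW; first by have [_] := right_step _ _ _ _ W0 r0; apply.
    have [r' e] := IHk (ltnW kW).
    by have [_] := right_step k.+1 m (col t k.+1) r' (ltnW kW) (congr1 tile_rgt e); apply.
  rewrite /col eC /=; case: j jW => [|j] jW.
    rewrite g0 /= E c0; congr (VHead _ (shift_contents _ _ _ _)).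
    by have [] := right_step _ _ _ _ W0 r0.
  have [r' e] := body _ jW; rewrite e /= cS; congr (VBody (shift_contents _ _ _ _)).
  by have [] := right_step _ _ _ _ jW (congr1 tile_rgt e).
have W0 : 0 < W by [].
have := topg _ W0; have := okg T.+1 0 (ltnSn _) W0; have := botS T 0 (ltnSn _) W0.
rewrite rowE //= -/(h.-1).
case: (g T.+1 0) => [b|[] a b|q c r'|m' l c r'|q c b|c b] //=.
  by case: head_step => [[]].
by move=> [_ ->] /eqP; rewrite /col ffunE /= => + _.
Qed.

Lemma tableauP : (exists g, rect_tiling g) <-> (exists2 u, size u <= Q & accepts_at u T).
Proof.
by split=> [[g /tableau_sound]|[u uQ /(tableau_complete uQ)]].
Qed.

End Input.
End Tableau.

(** * Printing the instance *)

Lemma size_subst_word w1 w0 s : size (subst_word w1 w0 s) <= (size w1 + size w0) * size s.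
Proof.
elim: s => [|b s IHs]; first by rewrite muln0.
rewrite /subst_word /= size_cat mulnS; apply: leq_add; last exact: IHs.
by case: b; rewrite ?leq_addr ?leq_addl.
Qed.

Lemma size_emit_words k (tmp o : 'I_k.+1) st B es :
  (forall i, i != o -> size (st i) <= B) -> all (emit_ok tmp o) es ->
  size (emit_words st es) <= emits_cost es * B.+1.
Proof.
move=> leB; elim: es => [|e es IHes] //= /andP[ok /IHes le].
rewrite /emit_words /= size_cat -/(emit_words _ _) /emits_cost /= mulnDl leq_add //.
case: e ok => [w _|[r [w1 w0]] /= /andP[_ ro]]; first by rewrite /=; nia.
have := size_subst_word w1 w0 (st r); have := leB r ro.
by rewrite /word_cost => le1 /leq_trans -> //; nia.
Qed.

(** * A printing program with unary counters *)

Section Emitter.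
(** [rTmp] and [rAcc] are scratch space for copying and multiplying. [rGuess], [rBlank], [rInner],
    [rGap] and [rCell] hold polynomials in the input length in unary; [rCell] also counts down
    through the cells. [rCap] keeps a part of the capacity code that recurs in every item. *)
Definition rX : 'I_10 := ord0.
Definition rTmp : 'I_10 := @Ordinal 10 1 isT.
Definition rAcc : 'I_10 := @Ordinal 10 2 isT.
Definition rGuess : 'I_10 := @Ordinal 10 3 isT.
Definition rBlank : 'I_10 := @Ordinal 10 4 isT.
Definition rInner : 'I_10 := @Ordinal 10 5 isT.
Definition rGap : 'I_10 := @Ordinal 10 6 isT.
Definition rCell : 'I_10 := @Ordinal 10 7 isT.
Definition rCap : 'I_10 := @Ordinal 10 8 isT.
Definition rOut : 'I_10 := ord_max.

Variables (pGuess pBlank pInner pGap pCell : {poly nat}).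
Variables (es_cap es_item : seq (emit 9)) (prefix : seq bool).
Hypotheses (ok_cap : all (emit_ok rTmp rCap) es_cap) (ok_item : all (emit_ok rTmp rOut) es_item).

Definition poly_prog (p : {poly nat}) (r : 'I_10) : prog 'I_10 void :=
  horner_prog rTmp rX r rAcc p.

(** Output is written from its end, so the capacity goes last, on top of the items; it is
    nevertheless computed before them because their penalties quote it. *)
Definition emitter_prog : prog 'I_10 void :=
  pseq (poly_prog pGuess rGuess) (pseq (poly_prog pBlank rBlank)
  (pseq (poly_prog pInner rInner) (pseq (poly_prog pGap rGap) (pseq (poly_prog pCell rCell)
  (pseq (emits rTmp rCap es_cap) (pseq (emit_loop rTmp rCell rOut es_item)
  (emits rTmp rOut [:: inl prefix; inr (rCap, ([:: true], [:: false]))]))))))).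

Definition unary (p : {poly nat}) (x : seq bool) : seq bool := nseq (p.[size x])%R true.

Definition emitter_regs (x : seq bool) : 'I_10 -> seq bool :=
  upd (upd (upd (upd (upd (reg_input x) rGuess (unary pGuess x)) rBlank (unary pBlank x))
    rInner (unary pInner x)) rGap (unary pGap x)) rCell (unary pCell x).

Definition emitter_cap x := emit_words (emitter_regs x) es_cap.

Definition emitter_output x := prefix ++ emitter_cap x ++
  flatten [seq emit_words (upd (upd (emitter_regs x) rCap (emitter_cap x)) rCell (nseq m true)) es_item
          | m <- iota 0 (pCell.[size x])%R].

Lemma subst_word_id s : subst_word [:: true] [:: false] s = s.
Proof. by elim: s => //= b s IHs; rewrite /subst_word /= -/(subst_word _ _ _) IHs; case: b. Qed.

Let size_bound (x : seq bool) := size x + (pGuess.[size x] + pBlank.[size x] + pInner.[size x] +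
  pGap.[size x] + pCell.[size x])%R.

Lemma emitter_regs_size x i : size (emitter_regs x i) <= size_bound x.
Proof.
have le p : size (unary p x) = (p.[size x])%R by rewrite size_nseq.
rewrite /emitter_regs /upd /reg_input /size_bound; do 6?case: eqP => _; rewrite ?le //=; lia.
Qed.

Lemma computes_poly_prog p r (x : seq bool) st :
  rX != r -> rTmp != r -> rAcc != r -> st rX = x -> st rTmp = [::] -> st r = [::] -> st rAcc = [::] ->
  computes (poly_prog p r) st (horner_cost p (size x)) (upd st r (unary p x)).
Proof.
move=> xr tr ar <- st0 str sta.
by apply: (@computes_horner 9 rTmp rX r rAcc) => //; rewrite eq_sym.
Qed.

Lemma emitter_polytime : polytime_solvable id (fun x y => y = emitter_output x).
Proof.
pose B0 n := n + (pGuess.[n] + pBlank.[n] + pInner.[n] + pGap.[n] + pCell.[n])%R.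
pose B1 n := B0 n + emits_cost es_cap * (B0 n).+1.
pose es_fin : seq (emit 9) := [:: inl prefix; inr (rCap, ([:: true], [:: false]))].
pose cost n := horner_cost pGuess n + (horner_cost pBlank n + (horner_cost pInner n +
  (horner_cost pGap n + (horner_cost pCell n + (emits_cost es_cap * (B0 n + 1) +
  (pCell.[n]%R * (emits_cost es_item * (B1 n + 1) + 2) +
   (emits_cost es_fin * (B1 n + 1)))))))) + 7.
have B0b : poly_bounded B0 by poly_bound.
have B1b : poly_bounded B1.
  by apply: (@poly_bounded_le _ (fun n => B0 n + emits_cost es_cap * (B0 n + 1))) => [n|];
     [rewrite addn1 | poly_bound].
apply: (@polytime_solvableI _ _ _ (reg_tm emitter_prog) cost).
  have := poly_bounded_horner_cost; rewrite /cost => hc.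
  by poly_bound; apply: hc.
move=> x; exists (emitter_output x); split=> //.
pose n := size x; pose st5 := emitter_regs x.
pose st6 := upd st5 rCap (emitter_cap x).
have h1 := @computes_poly_prog pGuess rGuess x (reg_input x) isT isT isT erefl erefl erefl erefl.
have h2 := @computes_poly_prog pBlank rBlank x (upd (reg_input x) rGuess (unary pGuess x))
  isT isT isT erefl erefl erefl erefl.
have h3 := @computes_poly_prog pInner rInner x
  (upd (upd (reg_input x) rGuess (unary pGuess x)) rBlank (unary pBlank x))
  isT isT isT erefl erefl erefl erefl.
have h4 := @computes_poly_prog pGap rGap x
  (upd (upd (upd (reg_input x) rGuess (unary pGuess x)) rBlank (unary pBlank x))
    rInner (unary pInner x)) isT isT isT erefl erefl erefl erefl.
have h5 := @computes_poly_prog pCell rCell x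
  (upd (upd (upd (upd (reg_input x) rGuess (unary pGuess x)) rBlank (unary pBlank x))
    rInner (unary pInner x)) rGap (unary pGap x)) isT isT isT erefl erefl erefl erefl.
rewrite -/(emitter_regs x) -/st5 in h5.
have le5 i : i != rCap -> size (st5 i) <= B0 n by move=> _; apply: emitter_regs_size.
have h6 := @computes_emits 9 rTmp rCap es_cap st5 (B0 n) isT erefl ok_cap le5.
rewrite -[st5 rCap]/([::] : seq bool) cats0 -/(emitter_cap x) -/st6 in h6.
have le6 i : i != rOut -> size (st6 i) <= B1 n.
  move=> _; rewrite /st6 /upd; case: eqP => _.
    by apply: leq_trans (size_emit_words le5 ok_cap) (leq_addl _ _).
  by apply: leq_trans (emitter_regs_size x i) (leq_addr _ _).
have h7 := @computes_emit_loop 9 rTmp rCell rOut es_item st6 (B1 n) (pCell.[n])%R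
  isT isT isT erefl ok_item le6 erefl.
set st7 := upd _ rOut _ in h7.
have le7 i : i != rOut -> size (st7 i) <= B1 n.
  by move=> io; rewrite /st7 upd_neq // /upd; case: eqP => // _; apply: le6.
have h8 := @computes_emits 9 rTmp rOut es_fin st7 (B1 n) isT erefl isT le7.
have := reg_tmP (computes_seq h1 (computes_seq h2 (computes_seq h3 (computes_seq h4
  (computes_seq h5 (computes_seq h6 (computes_seq h7 h8))))))).
rewrite -/rOut upd_same.
have -> : st7 rOut = flatten [seq emit_words (upd st6 rCell (nseq m true)) es_item
    | m <- iota 0 (pCell.[n])%R] by rewrite /st7 upd_same -[st6 rOut]/([::] : seq bool) cats0.
have -> : emit_words st7 es_fin = prefix ++ emitter_cap x.
  by rewrite /emit_words /= cats0 subst_word_id.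
rewrite -catA; apply: outputs_within_le; rewrite /cost -/n; lia.
Qed.

End Emitter.

(** [delimit] without its terminator is a morphism, so a code word can be emitted block by block. *)
Definition double (w : seq bool) : seq bool := flatten [seq [:: true; b] | b <- w].

Lemma delimitE w : delimit w = double w ++ [:: false]. Proof. by []. Qed.

Lemma double_cat w1 w2 : double (w1 ++ w2) = double w1 ++ double w2.
Proof. by rewrite /double map_cat flatten_cat. Qed.

Lemma double_flatten ss : double (flatten ss) = flatten [seq double s | s <- ss].
Proof. by elim: ss => //= s ss IHs; rewrite double_cat IHs. Qed.

Lemma size_double w : size (double w) = 2 * size w.
Proof. by elim: w => //= b w IHw; rewrite /double /= -/(double w) IHw; lia. Qed.

Lemma subst_word_nseq w m : subst_word w w (nseq m true) = flatten (nseq m w).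
Proof. by elim: m => //= m IHm; rewrite /subst_word /= -/(subst_word _ _ _) IHm. Qed.

Lemma double_nseq_flatten w m : double (flatten (nseq m w)) = flatten (nseq m (double w)).
Proof. by rewrite double_flatten map_nseq. Qed.

Lemma flatten_nseq_nseq (T : Type) (a : T) w m : flatten (nseq m (nseq w a)) = nseq (w * m) a.
Proof. by elim: m => [|m IHm] /=; [rewrite muln0 | rewrite IHm mulnS nseqD]. Qed.

Lemma map_iota_const (T : Type) (F : nat -> T) c a n :
  (forall k, a <= k < a + n -> F k = c) -> [seq F k | k <- iota a n] = nseq n c.
Proof.
elim: n a => //= n IHn a h; rewrite h ?leqnn ?addnS ?ltnS ?leq_addr // IHn // => k /andP[ak kn].
by apply: h; rewrite (ltnW ak) -addSnnS.
Qed.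

Lemma map_iota_seq (T U : Type) (x0 : T) (F : nat -> U) (G : T -> U) a s :
  (forall k, k < size s -> F (a + k) = G (nth x0 s k)) ->
  [seq F k | k <- iota a (size s)] = map G s.
Proof.
elim: s a => //= x s IHs a h; congr cons; first by rewrite -(h 0) ?addn0.
by apply: IHs => k ks; rewrite addSnnS (h k.+1).
Qed.

(** * The reduction and its running time *)

Section Reduction.
Variables (M : tm) (p q : {poly nat}).

Let tileT : finType := cell_tile M.
Let hT : finType := hcolour M.
Let vT : finType := vcolour M.
Let bw := bwidth tileT hT vT.
Let input_bits (v : vT) := bits bw (input_block tileT hT v).
Let inner_bits := bits bw (inner_block tileT hT vT).
Let final := final_block tileT hT (VFin M : vT).
Let final_bits := bits bw final.

(** A pair code with an admissible certificate has length at most [2 n + 1 + q(n)]. The same number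
    of steps serves all certificates, since halted runs repeat. *)
Definition run_poly : {poly nat} := (p \Po ('X + 'X + 1 + q))%R.
Definition width_poly : {poly nat} := ('X + 'X + 1 + q + run_poly + 1)%R.
Definition inner_poly : {poly nat} := ((run_poly + 1) * width_poly)%R.
Definition gap_poly : {poly nat} := ('X + 'X + q + run_poly)%R.
Definition cell_poly : {poly nat} := ((run_poly + 1 + 1) * width_poly)%R.

Let guesses (x : seq bool) : nat := (q.[size x])%R.
Let steps (x : seq bool) : nat := (run_poly.[size x])%R.
Let width x := tableau_width (delimit x) (guesses x) (steps x).
Let ncells x := tableau_height (steps x) * width x.
Let tinput x := tableau_input M (delimit x) (guesses x).

Definition knapsack_of (x : seq bool) : pkp :=
  subset_sum_pkp (cells (@tile_ok M : pred tileT) (ncells x))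
    (cell_weight (@tile_lft M : tileT -> option hT) (@tile_rgt M) (@tile_bot M : tileT -> vT)
       (@tile_top M) (width x))
    (target tileT hT (VFin M : vT) (width x) (ncells x) (tinput x)).

Lemma size_delimit x : size (delimit x) = 2 * size x + 1.
Proof. by rewrite delimitE size_cat size_double. Qed.

Lemma width2 x : 1 < width x.
Proof. by rewrite /width /tableau_width size_delimit; lia. Qed.

Let width0 x : 0 < width x. Proof. exact: ltnW (width2 x). Qed.

Lemma width_ncells x : width x <= ncells x.
Proof. by rewrite /ncells leq_pmull. Qed.

Lemma widthE x : (width_poly.[size x])%R = width x.
Proof.
by rewrite /width /tableau_width size_delimit /width_poly !hornerD hornerX hornerC -/(steps x) -/(guesses x); lia.
Qed.

Lemma cellE x : (cell_poly.[size x])%R = ncells x.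
Proof.
by rewrite /cell_poly hornerM widthE !hornerD !hornerC -/(steps x) -[(_ + 1 + 1)%R]/(steps x + 1 + 1) !addn1.
Qed.

Lemma innerE x : (inner_poly.[size x])%R + width x = ncells x.
Proof.
by rewrite /inner_poly hornerM widthE hornerD hornerC -/(steps x) -[(_ + 1)%R]/(steps x + 1) addn1 -mulSnr.
Qed.

Lemma gapE x : (gap_poly.[size x])%R = width x - 2.
Proof.
rewrite /gap_poly !hornerD hornerX -/(steps x) -/(guesses x) /width /tableau_width.
by rewrite size_delimit; lia.
Qed.

(** The two code bits of the leading 1 are omitted: a penalty needs its extra [false] right after
    them. An input bit fills two columns, as it is delimited. The [W] final blocks come as [W - 2]
    copies, one more, and an unpadded last one. *)
Definition cap_emits : seq (emit 9) :=
  let b v := double (input_bits v) in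
  [:: inl (behead (behead (b (VStart M))));
      inr (rX, (b (VIn M (Some true)) ++ b (VIn M (Some true)),
                b (VIn M (Some true)) ++ b (VIn M (Some false))));
      inl (b (VIn M (Some false)));
      inr (rGuess, (b (VGuess M), b (VGuess M)));
      inr (rBlank, (b (VIn M None), b (VIn M None)));
      inr (rInner, (double inner_bits, double inner_bits));
      inr (rGap, (double final_bits, double final_bits));
      inl (double final_bits ++ delimit (binary final))].

Definition weight_emits (pre : seq bool) (t : tileT) : seq (emit 9) :=
  let zeros := double (nseq bw false) in
  [:: inl (double pre); inr (rCell, (zeros, zeros));
      inl (double (bits bw (own_block (@tile_lft M : tileT -> option hT)
                              (@tile_bot M : tileT -> vT) t) ++
                   bits bw (right_block vT (@tile_rgt M : tileT -> option hT) t)));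
      inr (rGap, (zeros, zeros));
      inl (delimit (binary (top_block hT (@tile_top M : tileT -> vT) t)))].

(** The profit is the weight shifted by a leading [false]. The four constant bits are the code of
    the digits 1 and 0 with which the penalty begins, and [rCap] supplies the rest. *)
Definition tile_emits (t : tileT) : seq (emit 9) :=
  weight_emits [:: false] t ++ weight_emits [::] t ++
  [:: inl [:: true; true; true; false]; inr (rCap, ([:: true], [:: false]))].

Definition item_emits : seq (emit 9) :=
  flatten [seq tile_emits t | t <- enum (@tile_ok M : pred tileT)].

Let regs := emitter_regs q run_poly inner_poly gap_poly cell_poly.
Let word x := target_word tileT hT (VFin M : vT) (width x) (ncells x) (tinput x).

Lemma target_blocks x :
  [seq bits bw (target_block tileT hT (VFin M : vT) (width x) (ncells x) (tinput x) k)
     | k <- iota 0 (ncells x + width x).-1] =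
  input_bits (VStart M) :: [seq input_bits (VIn M (Some b)) | b <- delimit x] ++
    nseq (guesses x) (input_bits (VGuess M)) ++ nseq (steps x) (input_bits (VIn M None)) ++
    nseq (inner_poly.[size x])%R inner_bits ++ nseq (width x).-1 final_bits.
Proof.
have eW : width x = 1 + size (delimit x) + guesses x + steps x by rewrite /width /tableau_width; lia.
have eN := innerE x; set m := (inner_poly.[size x])%R in eN *.
have [w ew] : exists w, (width x).-1 = w by exists (width x).-1.
have -> : (ncells x + width x).-1 =
    1 + (size (delimit x) + (guesses x + (steps x + (m + w)))) by have := width2 x; lia.
rewrite ew.
set F := (F in map F _).
rewrite !iotaD !(map_cat F) (_ : map F (iota 0 1) = [:: F 0]) // cat_cons cat0s !add0n.
have F0 : F 0 = input_bits (VStart M) by rewrite /F /target_block width0.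
rewrite F0; congr (_ :: _ ++ _ ++ _ ++ _ ++ _).
- apply: (@map_iota_seq _ _ false) => k kd; rewrite /F /target_block.
  have -> : 1 + k < width x by lia.
  by rewrite /tinput /= kd.
- apply: map_iota_const => k /andP[k1 k2]; rewrite /F /target_block.
  have -> : k < width x by lia.
  case: k k1 k2 => [|k] k1 k2; first by lia.
  rewrite /tinput /= ltnNge (_ : size (delimit x) <= k) /=; last by lia.
  by have -> : k < size (delimit x) + guesses x by lia.
- apply: map_iota_const => k /andP[k1 k2]; rewrite /F /target_block.
  have -> : k < width x by lia.
  case: k k1 k2 => [|k] k1 k2; first by lia.
  rewrite /tinput /= !ltnNge (_ : size (delimit x) <= k) /=; last by lia.
  by have -> : size (delimit x) + guesses x <= k by lia.
- apply: map_iota_const => k /andP[k1 k2]; rewrite /F /target_block.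
  have -> : (k < width x) = false by apply/negbTE; rewrite -leqNgt; lia.
  by have -> : k < ncells x by lia.
- apply: map_iota_const => k /andP[k1 k2]; rewrite /F /target_block.
  have -> : (k < width x) = false by apply/negbTE; rewrite -leqNgt; lia.
  by have -> : (k < ncells x) = false by apply/negbTE; rewrite -leqNgt; lia.
Qed.

Lemma double_delimit_blocks x :
  flatten [seq double (input_bits (VIn M (Some b))) | b <- delimit x] =
  subst_word (double (input_bits (VIn M (Some true))) ++ double (input_bits (VIn M (Some true))))
    (double (input_bits (VIn M (Some true))) ++ double (input_bits (VIn M (Some false)))) x
  ++ double (input_bits (VIn M (Some false))).
Proof.
rewrite delimitE map_cat flatten_cat /= cats0; congr (_ ++ _).
elim: x => //= b x IHx; rewrite /double /= -/(double x) IHx /subst_word /=.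
by case: b; rewrite catA.
Qed.

Lemma regs_unary x : [/\ regs x rX = x, regs x rGuess = nseq (guesses x) true,
  regs x rBlank = nseq (steps x) true, regs x rInner = nseq (inner_poly.[size x])%R true &
  regs x rGap = nseq (width x - 2) true].
Proof. by split=> //; rewrite -gapE. Qed.

Lemma word_delimit x : delimit (word x) = [:: true, true & delimit (behead (word x))].
Proof.
by rewrite /word {1}(target_word_cons _ _ _ _ (width0 x) (width_ncells x) (width2 x)).
Qed.

Lemma cap_emitsE x : emit_words (regs x) cap_emits = delimit (behead (word x)).
Proof.
have -> : delimit (behead (word x)) = behead (behead (delimit (word x))) by rewrite word_delimit.
rewrite delimitE /word /target_word target_blocks.
have -> : (width x).-1 = (width x - 2) + 1 by have := width2 x; lia.
rewrite double_cat double_flatten map_cons !(map_cat double) !map_nseq -map_comp [flatten (_ :: _)]/=.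
rewrite !flatten_cat double_delimit_blocks nseqD flatten_cat /= cats0.
have [rx _ _ _ _] := regs_unary x.
rewrite /emit_words /= !subst_word_nseq cats0.
have : 1 < size (double (input_bits (VStart M))) by rewrite size_double size_bits /bw /bwidth /dwidth; lia.
case: (double (input_bits (VStart M))) => [|b1 [|b2 s]] //= _.
by rewrite delimitE -!catA rx -gapE.
Qed.

Lemma weight_emitsE st m pre t x : st rCell = nseq m true -> st rGap = nseq (width x - 2) true ->
  emit_words st (weight_emits pre t) =
  delimit (pre ++ weight_word (@tile_lft M : tileT -> option hT) (@tile_rgt M)
    (@tile_bot M : tileT -> vT) (@tile_top M) (width x) m t).
Proof.
move=> ec eg; rewrite /emit_words /= cats0 ec eg !subst_word_nseq !delimitE /weight_word.
by rewrite !double_cat -!double_nseq_flatten !flatten_nseq_nseq -!catA.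
Qed.

Lemma emit_words_cat k (st : 'I_k.+1 -> seq bool) es1 es2 :
  emit_words st (es1 ++ es2) = emit_words st es1 ++ emit_words st es2.
Proof. by rewrite /emit_words map_cat flatten_cat. Qed.

Lemma emit_words_flatten k (st : 'I_k.+1 -> seq bool) ess :
  emit_words st (flatten ess) = flatten [seq emit_words st es | es <- ess].
Proof. by elim: ess => //= es ess IH; rewrite emit_words_cat IH. Qed.

Lemma tile_emitsE st m t x : st rCell = nseq m true -> st rGap = nseq (width x - 2) true ->
  st rCap = delimit (behead (word x)) ->
  let w := cell_weight (@tile_lft M : tileT -> option hT) (@tile_rgt M)
    (@tile_bot M : tileT -> vT) (@tile_top M) (width x) (m, t) in
  emit_words st (tile_emits t) = nat_code (2 * w) ++ nat_code w ++
    nat_code (2 * target tileT hT (VFin M : vT) (width x) (ncells x) (tinput x)).-1.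
Proof.
move=> ec eg ecap /=; rewrite /tile_emits !emit_words_cat !(weight_emitsE _ _ ec eg).
rewrite /nat_code (binary_profit _ _ _ _ (width0 x) (width_ncells x) (width2 x)).
rewrite (binary_weight _ _ _ _ (width0 x) (width_ncells x) (width2 x)).
rewrite (binary_penalty _ _ _ _ (width0 x) (width_ncells x) (width2 x)).
by rewrite /emit_words /= cats0 subst_word_id ecap.
Qed.

Lemma flatten_map_allpairs (T U : Type) (f : T * U -> seq bool) s r :
  flatten [seq f p | p <- [seq (a, b) | a <- s, b <- r]] =
  flatten [seq flatten [seq f (a, b) | b <- r] | a <- s].
Proof.
by elim: s => //= a s IHs; rewrite map_cat flatten_cat IHs -map_comp.
Qed.

Lemma emitter_outputE x :
  emitter_output q run_poly inner_poly gap_poly cell_poly cap_emits item_emits [:: true; true] x =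
  pkp_code (knapsack_of x).
Proof.
rewrite /knapsack_of subset_sum_code /emitter_output /emitter_cap -/regs cap_emitsE catA.
congr (_ ++ _).
  rewrite /nat_code (binary_target _ _ _ _ (width0 x) (width_ncells x) (width2 x)) -/(word x).
  by rewrite word_delimit.
rewrite flatten_map_allpairs cellE; congr flatten; apply: eq_map => m.
rewrite /item_emits emit_words_flatten -map_comp; congr flatten; apply: eq_map => t /=.
apply: tile_emitsE; rewrite ?upd_same // upd_neq // upd_neq //.
by have [_ _ _ _ ->] := regs_unary x.
Qed.

Lemma knapsack_polytime : polytime_solvable id (fun x y => y = pkp_code (knapsack_of x)).
Proof.
have ok_item : all (emit_ok rTmp rOut) item_emits.
  by rewrite /item_emits; elim: (enum _) => //= t s; rewrite all_cat => ->.
have ok_cap : all (emit_ok rTmp rCap) cap_emits by [].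
have [N [r hN]] := emitter_polytime q run_poly inner_poly gap_poly cell_poly [:: true; true] ok_cap ok_item.
exists N, r => x; have [y [oy ey]] := hN x.
by exists y; split=> //; rewrite ey emitter_outputE.
Qed.

(** Between halting and row [t] nothing changes, and a one-bit output lies under the output head. *)
Lemma accepts_atE d u t n v : outputs_within M (d ++ u) n [:: v] -> n <= t ->
  accepts_at M d u t <-> v.
Proof.
move=> /outputs_withinP[tp [k [s [kn e hlt]]] [o _]] nt.
rewrite /accepts_at -(subnK (leq_trans kn nt)) iterD e iter_fstep_halted //= (o 0) //=.
by split=> [[->]|->].
Qed.

Lemma knapsack_ofP (Ver : language) x :
  (forall z, outputs_within M z (p.[size z])%R [:: Ver z]) ->
  (exists y : solution (knapsack_of x), load y = capacity (knapsack_of x)) <->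
  exists u, size u <= (q.[size x])%R /\ Ver (pair_code x u).
Proof.
move=> hV; rewrite /knapsack_of subset_sumP ?uniq_cells //.
rewrite -tiling_sumP ?width0 ?width_ncells //.
rewrite (@rect_tilingP _ _ _ _ _ _ _ _ _ _ _ _ _ _ (@first_column M)); first last.
- by move=> j _; apply: first_column_input.
- exact: tile_bot_fin.
- exact: first_column_top.
- exact: first_column_lft.
- by [].
- exact: width0.
rewrite tableauP ?size_delimit ?addn1 //.
have acc u : size u <= guesses x -> accepts_at M (delimit x) u (steps x) <-> Ver (pair_code x u).
  move=> ug; apply: (accepts_atE (hV _)).
  rewrite size_cat size_delimit /steps /run_poly horner_comp; apply: horner_nat_mono.
  by rewrite !hornerD hornerX hornerC -/(guesses x); lia.
split=> [[u ug /(acc u ug) h]|[u [ug h]]]; first by exists u.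
by exists u => //; apply/acc.
Qed.

Lemma knapsack_capacity_gt0 x : 0 < capacity (knapsack_of x).
Proof. exact: target_gt0 (width0 x) (width_ncells x) (width2 x). Qed.

End Reduction.

Theorem theorem3 (R : realType) :
  ~ P_equals_NP ->
  ~ exists r : R, (1 <= r)%R /\ polytime_solvable pkp_code (is_approximation r).
Proof.
move=> nPNP [r [r1 hA]]; apply: nPNP => L; split; first exact: inP_inNP.
move=> [Ver [q [[M [p hV]] hL]]].
have {}hV z : outputs_within M z (p.[size z])%R [:: Ver z].
  by have [y [oy <-]] := hV z.
have hP : polytime_solvable id (fun x y => is_approximation r (knapsack_of M p q x) y).
  apply: (polytime_solvable_comp (knapsack_polytime M p q) hA) => x _ ->.
  by exists (knapsack_of M p q x).
(* Membership in [L] is decided by looking for a selected item in the packing returned. *)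
apply: (polytime_solvable_comp hP has_true_polytime) => x y gy; exists y => // z ->.
have T0 := knapsack_capacity_gt0 M p q x.
congr [:: _]; apply/idP/idP => h.
  apply/hL; apply: (proj1 (knapsack_ofP q x hV)).
  exact: (proj1 (approximation_gap T0 r1 gy) h).
apply: (proj2 (approximation_gap T0 r1 gy)).
apply: (proj2 (knapsack_ofP q x hV)).
exact/hL.
Qed.
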